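(* Let $G$ be a finite group such that the graph $\Delta(G)$ has a cut vertex $r$. Then the following conclusions hold. (a) $G$ is a solvable group whose Fitting height is at most $3$. (b) $\Delta(G)-r$ is a graph with exactly two connected components, and both of them are complete graphs. (c) If $r$ is a complete vertex of $\Delta(G)$, then $r$ is the unique complete vertex and the unique cut vertex of $\Delta(G)$. If $r$ is not a complete vertex of $\Delta(G)$, then $\Delta(G)$ is a graph of diameter $3$, and it has at most two cut vertices.
   Context: All groups are finite. For a finite group $G$, $\Delta(G)$ is the simple undirected graph whose vertex set $V(G)$ is the set of primes dividing the size of some conjugacy class of $G$; two distinct vertices $p,q$ are adjacent if and only if $pq$ divides the size of some conjugacy class of $G$. For a graph $\Delta$ with vertex set $V$ and $r\in V$, $\Delta-r$ denotes the subgraph induced by $V\setminus\{r\}$. The vertex $r$ is a cut vertex of $\Delta$ if $\Delta-r$ has more connected components than $\Delta$. The vertex $r$ is complete if it is adjacent to all the other vertices of $\Delta$. *)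

(* Defs.v *)
From HB Require Import structures.
From mathcomp Require Import all_boot all_fingroup all_solvable.

Set Implicit Arguments.
Unset Strict Implicit.
Unset Printing Implicit Defensive.

Import GroupScope.

(* Finite simple graphs whose vertices form a subset of an ambient finType, so
   that deleting a vertex does not change the type of the remaining ones. *)

Record sgraph (T : finType) := SGraph {
  gverts : {set T};
  gadj : rel T;
  gadj_sym : symmetric gadj;
  gadj_irrefl : irreflexive gadj;
  gadj_verts : forall x y, gadj x y -> x \in gverts
}.

Section Graphs.

Variable T : finType.
Implicit Types (Gr : sgraph T) (S C : {set T}) (x y r : T).

Definition ind_adj Gr S : rel T :=
  [rel x y | [&& x \in S, y \in S & gadj Gr x y]].

Lemma ind_adj_sym Gr S : symmetric (ind_adj Gr S).
Proof. by move=> x y; rewrite /ind_adj /= (gadj_sym Gr x y) andbCA. Qed.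

Lemma ind_adj_irrefl Gr S : irreflexive (ind_adj Gr S).
Proof. by move=> x; rewrite /ind_adj /= (gadj_irrefl Gr x) !andbF. Qed.

Lemma ind_adj_verts Gr S x y :
  ind_adj Gr S x y -> x \in gverts Gr :&: S.
Proof. by case/and3P=> xS _ /gadj_verts xV; rewrite inE xV. Qed.

Definition induced Gr S : sgraph T :=
  SGraph (@ind_adj_sym Gr S) (@ind_adj_irrefl Gr S) (@ind_adj_verts Gr S).

Definition del_vertex Gr r : sgraph T := induced Gr (gverts Gr :\ r).

Definition components Gr : {set {set T}} :=
  equivalence_partition (connect (gadj Gr)) (gverts Gr).

Definition is_connected Gr : bool :=
  [forall x in gverts Gr, forall y in gverts Gr, connect (gadj Gr) x y].

Definition complete_graph Gr : bool :=
  [forall x in gverts Gr, forall y in gverts Gr, (x != y) ==> gadj Gr x y].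

Definition complete_vertex Gr r : bool :=
  (r \in gverts Gr) && [forall y in gverts Gr, (y != r) ==> gadj Gr r y].

Definition cut_vertex Gr r : bool :=
  (r \in gverts Gr) && (#|components Gr| < #|components (del_vertex Gr r)|).

Definition walk_of_length Gr x y n : bool :=
  [exists p : n.-tuple T, path (gadj Gr) x p && (last x p == y)].

(* Meaningful only for connected x and y, see distanceP. *)
Definition distance Gr x y : nat :=
  find (walk_of_length Gr x y) (iota 0 #|T|).

(* A disconnected graph has infinite diameter, represented by None. *)
Definition diameter Gr : option nat :=
  if is_connected Gr
  then Some (\max_(x in gverts Gr) \max_(y in gverts Gr) distance Gr x y)
  else None.

Lemma distanceP Gr x y : connect (gadj Gr) x y ->
  walk_of_length Gr x y (distance Gr x y) /\
  (forall n, walk_of_length Gr x y n -> distance Gr x y <= n).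
Proof.
case/connectP=> p0 /shortenP[p pth Up _] Dy.
have hasw : has (walk_of_length Gr x y) (iota 0 #|T|).
  apply/hasP; exists (size p); last first.
    by apply/existsP; exists (in_tuple p); rewrite pth Dy /=.
  by rewrite mem_iota add0n; have := max_card (mem (x :: p)); rewrite (card_uniqP Up).
have ltT : distance Gr x y < #|T| by move: hasw; rewrite has_find size_iota.
split=> [|n wn].
  by have := nth_find 0 hasw; rewrite nth_iota ?add0n.
rewrite leqNgt; apply/negP=> lt_n.
have := before_find 0 lt_n; rewrite nth_iota ?(ltn_trans lt_n) //.
by rewrite add0n wn.
Qed.

End Graphs.

Section ClassGraph.

Variables (gT : finGroupType) (G : {group gT}).

(* A vertex divides #|G|, so the bound on the ambient type 'I_#|G|.+1 loses no
   prime, see class_vertsP. *)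
Definition class_verts : {set 'I_#|G|.+1} :=
  [set p : 'I_#|G|.+1 | prime p & [exists x in G, p %| #|x ^: G|]].

(* %N matters: in group_scope, * on 'I_#|G|.+1 would be addition mod #|G|.+1. *)
Definition class_adj : rel 'I_#|G|.+1 :=
  [rel p q | [&& p \in class_verts, q \in class_verts, p != q
               & [exists x in G, (p * q)%N %| #|x ^: G|]]].

Lemma class_adj_sym : symmetric class_adj.
Proof.
move=> p q; rewrite /class_adj /= [in RHS]andbCA [in RHS]eq_sym; do 3!congr (_ && _).
by apply: eq_existsb => x; rewrite mulnC.
Qed.

Lemma class_adj_irrefl : irreflexive class_adj.
Proof. by move=> p; rewrite /class_adj /= eqxx /= !andbF. Qed.

Lemma class_adj_verts p q : class_adj p q -> p \in class_verts.
Proof. by case/andP. Qed.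

Definition class_graph : sgraph 'I_#|G|.+1 :=
  SGraph class_adj_sym class_adj_irrefl class_adj_verts.

Lemma class_vertsP (p : nat) :
  (exists2 v, v \in gverts class_graph & p = v) <->
  prime p /\ exists2 x, x \in G & p %| #|x ^: G|.
Proof.
split=> [[v] | [pr_p [x Gx p_x]]].
  by rewrite inE => /andP[pr_v /exists_inP[x Gx v_x]] ->; split=> //; exists x.
have le_pG : p < #|G|.+1.
  rewrite ltnS dvdn_leq ?cardG_gt0 // (dvdn_trans p_x) //.
  by rewrite -index_cent1 dvdn_indexg.
exists (Ordinal le_pG) => //; rewrite inE pr_p.
by apply/exists_inP; exists x.
Qed.

(* F_0 = 1 and F_(n+1) / F_n = 'F(G / F_n). *)
Definition fitting_series (n : nat) : {group gT} :=
  iter n (fun H : {group gT} => coset H @*^-1 'F(G / H))%G 1%G.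

(* The least n such that F_n = G, which exists when G is solvable, see
   fitting_heightP; the value #|G|.+1 for other groups has no meaning. *)
Definition fitting_height : nat :=
  find (fun n => fitting_series n == G) (iota 0 #|G|.+1).

Lemma fitting_series_normal n : fitting_series n <| G.
Proof.
elim: n => [|n IHn]; first exact: normal1.
by rewrite /= -{2}(quotientGK IHn) cosetpre_normal Fitting_normal.
Qed.

Lemma fitting_heightP : solvable G ->
  fitting_series fitting_height = G /\
  (forall n, fitting_series n = G -> fitting_height <= n).
Proof.
move=> solG.
have grow n : (fitting_series n == G) || (n < #|fitting_series n|).
  elim: n => [|n IHn]; first by rewrite cards1 orbT.
  have nF := fitting_series_normal n.
  have lt_card : fitting_series n != G ->
      #|fitting_series n| < #|fitting_series n.+1|.
    move=> neG; rewrite card_cosetpre -{1}[#|_|]muln1.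
    rewrite ltn_pmul2l ?cardG_gt0 // cardG_gt1 trivg_Fitting ?quotient_sol //.
    apply: contra neG => /eqP G1; rewrite -val_eqE eqEsubset normal_sub //=.
    by rewrite -quotient_sub1 ?normal_norm // G1.
  have [FG | neG] := eqVneq (fitting_series n) G.
    apply/orP; left; rewrite -val_eqE eqEsubset normal_sub ?fitting_series_normal //=.
    by rewrite -{1}FG sub_cosetpre.
  apply/orP; right; apply: leq_trans (lt_card neG).
  by move: IHn; rewrite (negPf neG).
have hasF : has (fun n => fitting_series n == G) (iota 0 #|G|.+1).
  apply/hasP; exists #|G|; first by rewrite mem_iota add0n ltnS leqnn.
  have := grow #|G|; case/orP=> //; rewrite ltnNge subset_leq_card //.
  exact: normal_sub (fitting_series_normal _).
have lt_h : fitting_height < #|G|.+1 by move: hasF; rewrite has_find size_iota.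
split=> [|n Fn]; first by apply/eqP; have := nth_find 0 hasF; rewrite nth_iota.
rewrite leqNgt; apply/negP=> lt_n.
have := before_find 0 lt_n; rewrite nth_iota ?(ltn_trans lt_n) //.
by rewrite add0n Fn eqxx.
Qed.

End ClassGraph.

(* Main.v *)
(* Let A and B be unions of connected components of Delta(G) - r with A :|: B = V \ {r} and no
   edge between them.  For a in A and b in B every element of G centralizes a Sylow a- or
   b-subgroup, so counting the conjugates of C_G(P) and C_G(Q) forces N_G(P) = C_G(P) or
   N_G(Q) = C_G(Q); hence, up to exchanging A and B, N_G(P) = C_G(P) for every a in A.  By
   transfer, G' is then contained in K = O_{A'}(G).  An element of K whose G-class size is
   divisible by a prime of A has a K-class of r-power size, so Burnside's theorems on such
   classes and on groups of order p^a q^b make K, hence G, solvable.  With U = O_{B'}(K) and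
   N / U = F(K / U), the groups U, N / U and G / N are nilpotent.  Finally no three vertices of
   Delta(G) of the relevant kinds (two in A and one in B, one in A and two in B, or one in A,
   one in B and r) are pairwise nonadjacent, and the statements on Delta(G) follow from this. *)
Require Import Defs.
From mathcomp Require Import all_boot all_fingroup all_solvable all_character.

Set Implicit Arguments.
Unset Strict Implicit.
Unset Printing Implicit Defensive.

Import GroupScope.

(** * Covering a group by conjugates of subgroups *)

Section ClassSupport.

Variable gT : finGroupType.
Implicit Types (G H K M N P Q X Y D : {group gT}) (x y z : gT) (p q : nat).

(** If N_G(P) is larger than C_G(P), the conjugates of C_G(P) cover fewer than half of the elements,
    so two such families cannot cover G. A failure at one a in A thus settles every b in B, and this
    is what permits the exchange of A and B. After it the sides are no longer symmetric: for a prime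
    of B, N_G(Q) = C_G(Q) is known only when nonadjacency of two primes of B provides it, so the two
    cliques need different proofs. The separation says nothing on r, which is why nilpotency is
    always obtained from the centrality of p-elements for p <> r. The recurrent scheme: a
    restriction on class sizes says that conjugates of two subgroups cover a group; this is
    transported to a nilpotent section, which conjugates of two proper subgroups never cover. *)

Lemma class_supportP (A B : {set gT}) x :
  reflect (exists2 g, g \in B & x ^ g^-1 \in A) (x \in class_support A B).
Proof.
rewrite class_supportEr; apply: (iffP bigcupP) => [] [g Bg]; last first.
  by rewrite -mem_conjg; exists g.
by rewrite mem_conjg; exists g.
Qed.

Lemma class_supportS (A A' B B' : {set gT}) :
  A \subset A' -> B \subset B' -> class_support A B \subset class_support A' B'.
Proof.
move=> /subsetP sA /subsetP sB; apply/subsetP=> x /class_supportP[g /sB Bg /sA Ax].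
by apply/class_supportP; exists g.
Qed.

Lemma card_class_supportD1 G M :
  #|(class_support M G)^#| <= #|G : 'N_G(M)| * #|M|.-1.
Proof.
rewrite class_supportD1 (leq_trans (leq_card_cover _)) //.
have -> : #|G : 'N_G(M)| = #|M^# :^: G|.
  by rewrite card_conjugates normD1.
rewrite (eq_bigr (fun=> #|M|.-1)) ?sum_nat_const // => _ /imsetP[g _ ->].
by rewrite cardJg (cardsD1 1 M) group1.
Qed.

(** Counting: |G : N_G(M)| (|M| - 1) is at most |G : M| (|M| - 1) = |G| - |G : M|, which is less
    than |G| - 1. *)
Lemma class_support_proper G M :
  M \proper G -> exists2 x, x \in G & x \notin class_support M G.
Proof.
move=> prM; have sMG := proper_sub prM; apply/subsetPn/negP=> sG.
have := card_class_supportD1 G M.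
have -> : #|(class_support M G)^#| = #|G|.-1.
  rewrite (_ : class_support M G = G) ?(cardsD1 1 G) ?group1 //.
  by apply/eqP; rewrite eqEsubset sG class_support_subG.
apply/negP; rewrite -ltnNge.
have sMN : M \subset 'N_G(M) by rewrite subsetI sMG normG.
have iGM : 1 < #|G : M| by rewrite indexg_gt1; case/andP: prM.
rewrite -(Lagrange sMG) mulnC -(Lagrange_index (subsetIl G 'N(M)) sMN).
move: iGM; rewrite -(Lagrange_index (subsetIl G 'N(M)) sMN) mulnC.
have := indexg_gt0 'N_G(M) M; have := cardG_gt0 M.
move: #|G : _| #|_ : M| => n k; case: #|M| => // m _ k_gt0 nk_gt1.
rewrite mulSn /= -ltnS prednK ?addn_gt0 ?(ltnW nk_gt1) //.
by rewrite -addn2 addnC leq_add // leq_mul2l leq_pmull ?orbT.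
Qed.

(** Here |G : N_G(M)| |M| is at most |G| / 2. The [.+2] records strictness: two such families
    together miss a nonidentity element. *)
Lemma class_support_half G M :
  M \subset G -> ~~ ('N_G(M) \subset M) ->
  #|(class_support M G)^#|.*2.+2 <= #|G|.
Proof.
move=> sMG nNM; have le1 := card_class_supportD1 G M.
have sMN : M \subset 'N_G(M) by rewrite subsetI sMG normG.
have iN : 1 < #|'N_G(M) : M| by rewrite indexg_gt1.
rewrite (@leq_trans ((#|G : 'N_G(M)| * #|M|).*2)) //.
  rewrite -doubleS leq_double (leq_ltn_trans le1) //.
  by rewrite ltn_pmul2l ?indexg_gt0 // prednK ?cardG_gt0.
rewrite -(Lagrange (subsetIl G 'N(M))) -(Lagrange sMN) -mul2n.
by rewrite [leqRHS]mulnC mulnCA leq_mul2l mulnC leq_mul2l iN !orbT.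
Qed.

Lemma cover_centralizers G P Q :
  P \subset G -> Q \subset G ->
  G \subset class_support 'C_G(P) G :|: class_support 'C_G(Q) G ->
  'N_G(P) \subset 'C(P) \/ 'N_G(Q) \subset 'C(Q).
Proof.
move=> sPG sQG covG.
have half R : ~~ ('N_G(R) \subset 'C(R)) ->
    #|(class_support 'C_G(R) G)^#|.*2.+2 <= #|G|.
  move=> nR; apply: class_support_half; first exact: subsetIl.
  (* N_G(R) normalizes C_G(R): if C_G(R) is self-normalizing, it contains N_G(R). *)
  apply: contra nR => sNC; apply: subset_trans (subsetIr G _).
  apply: subset_trans sNC; rewrite subsetI subsetIl normsI ?norms_cent //.
    by rewrite (subset_trans (subsetIl _ _)) ?normG.
  exact: subsetIr.
have [? | nP] := boolP ('N_G(P) \subset 'C(P)); [by left | right].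
apply/negP=> /negP nQ; have := leq_add (half _ nP) (half _ nQ).
apply/negP; rewrite -ltnNge !addSn !addnS -doubleD addnn -!doubleS ltn_double.
rewrite ltnS (cardsD1 1 G) group1 add1n ltnS.
apply: leq_trans (leq_of_leqif (leq_card_setU _ _)).
by rewrite -setDUl subset_leq_card ?setSD.
Qed.

Lemma two_proper_subgroups G M N :
  M \proper G -> N \proper G -> exists2 x, x \in G & (x \notin M) && (x \notin N).
Proof.
case/andP=> sMG /subsetPn[x Gx nMx] /andP[sNG /subsetPn[y Gy nNy]].
have [Nx | nNx] := boolP (x \in N); last by exists x => //; rewrite nMx.
have [My | nMy] := boolP (y \in M); last by exists y => //; rewrite nMy.
by exists (x * y); [rewrite groupM | rewrite groupMr // nMx groupMl].
Qed.

Lemma nilpotent_proper_normal Y D :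
  nilpotent Y -> D \proper Y -> exists2 X : {group gT}, D \subset X & X <| Y /\ X \proper Y.
Proof.
move=> nilY prD.
have [X /maxgroupP[prX maxX] sDX] :
  {X : {group gT} | maxgroup X (fun X => gval X \proper Y) & D \subset X}.
  exact: maxgroup_exists.
exists X => //; split=> //; have sXY := proper_sub prX.
rewrite /normal sXY; apply: contraLR (nilpotent_proper_norm nilY prX) => nXY.
have sXN : X \subset 'N_Y(X) by rewrite subsetI sXY normG.
have prN : 'N_Y(X) \proper Y.
  rewrite properE subsetIl; apply: contra nXY => /subset_trans-> //.
  exact: subsetIr.
by have /= -> := maxX 'N_Y(X)%G prN sXN; rewrite properxx.
Qed.

(** All conjugates of a proper subgroup of a nilpotent group lie in one proper normal subgroup, and
    two proper subgroups never cover a group. *)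
Lemma nilpotent_cover Y D D' :
  nilpotent Y -> D \subset Y -> D' \subset Y ->
  Y \subset class_support D Y :|: class_support D' Y ->
  D :=: Y \/ D' :=: Y.
Proof.
move=> nilY sDY sD'Y covY.
have [-> | prD] := eqVproper sDY; first by left.
have [-> | prD'] := eqVproper sD'Y; first by right.
have [X sDX [nXY prX]] := nilpotent_proper_normal nilY prD.
have [X' sDX' [nXY' prX']] := nilpotent_proper_normal nilY prD'.
have [x Yx /andP[nXx nXx']] := two_proper_subgroups prX prX'.
have := subsetP covY x Yx; rewrite inE => /orP[] csx.
  by case/negP: nXx; apply: subsetP csx; rewrite class_support_sub_norm ?normal_norm.
by case/negP: nXx'; apply: subsetP csx; rewrite class_support_sub_norm ?normal_norm.
Qed.

End ClassSupport.

(** * Fusion and transfer for a Sylow subgroup central in its normalizer *)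

Section Transfer.

Variable gT : finGroupType.
Implicit Types (G H K M N P Q X Y D : {group gT}) (x y z : gT) (p q : nat).

(** Burnside's argument: [P] and [P :^ y] are Sylow in the centralizer of [x ^ y], hence conjugate
    there; so [y] lies in N_G(P) up to a factor that fixes [x ^ y]. *)
Lemma central_Sylow_fusion p G P x y :
  p.-Sylow(G) P -> 'N_G(P) \subset 'C(P) -> x \in P -> y \in G -> x ^ y \in P ->
  x ^ y = x.
Proof.
move=> sylP cNP Px Gy Pxy; have [sPG pP _] := and3P sylP.
have cPP : abelian P by apply: subset_trans cNP; rewrite subsetI sPG normG.
set C := 'C_G[x ^ y]; have sCG : C \subset G by apply: subsetIl.
have sPC : P \subset C by rewrite subsetI sPG sub_cent1 (subsetP cPP).
have sPyC : P :^ y \subset C.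
  by rewrite subsetI -(conjGid Gy) conjSg sPG cent1J conjSg sub_cent1 (subsetP cPP).
have sylPC := pHall_subl sPC sCG sylP.
have sylPyC : p.-Sylow(C) (P :^ y).
  by apply: pHall_subl sPyC sCG _; rewrite pHallJ.
have [c /setIP[Gc /cent1P cc] def_Py] := Sylow_trans sylPC sylPyC.
have Nyc : y * c^-1 \in 'N_G(P).
  rewrite inE groupM ?groupV //=; apply/normP.
  by rewrite conjsgM /= def_Py conjsgK.
have fx : x ^ (y * c^-1) = x.
  apply/conjg_fixP/commgP; exact/commute_sym/(centP (subsetP cNP _ Nyc)).
rewrite -[in RHS]fx conjgM; apply/esym/conjg_fixP/commgP.
exact/commute_sym/commute_sym/commuteV.
Qed.

(* The transfer into P sends x in P to x ^+ #|G : P|. *)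
Lemma Burnside_transfer p G P :
  p.-Sylow(G) P -> 'N_G(P) \subset 'C(P) -> p^'.-group G^`(1).
Proof.
move=> sylP cNP; have [sPG pP _] := and3P sylP.
have cPP : abelian P by apply: subset_trans cNP; rewrite subsetI sPG normG.
have tiPG' : P :&: G^`(1) = 1.
  have abelP : abelian (idm P @* P) by rewrite morphim_idm.
  have sG'K : G^`(1) \subset 'ker (transfer_morphism G abelP).
    rewrite gen_subG; apply/subsetP=> _ /imset2P[x y Gx Gy ->].
    apply/kerP; rewrite ?groupR // morphR //.
    by apply/eqP/commgP; apply: (centsP (finalg.FinRing.zmod_abelian setT)); rewrite inE.
  apply/trivgP/subsetP=> x /setIP[Px /(subsetP sG'K)/mker /=].
  have Gx := subsetP sPG x Px.
  (* This transversal follows the orbits of [x] on the cosets of [P], so every factor of the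
     transfer is a conjugate of a power of [x] lying in [P]; by fusion it is that power. *)
  have [X trX] : exists X : {set gT}, is_transversal X (rcosets P G :* <[x]>) G.
    by exists (transversal (rcosets P G :* <[x]>) G); apply/transversalP/rcosets_cycle_partition.
  rewrite (transfer_cycle_expansion sPG abelP Gx trX).
  rewrite (eq_bigr (fun y => FiniteModule.fmod abelP (x ^+ #|<[x]> : P :* y|))); last first.
    move=> y Xy /=; have Gy := subsetP (transversal_sub trX) y Xy.
    congr (FiniteModule.fmod _ _); apply: (central_Sylow_fusion sylP cNP).
    - exact: groupX.
    - by rewrite groupV.
    - have := mulg_exp_card_rcosets P x y; rewrite mem_rcoset conjgE invgK.
      by rewrite mulgA.
  have idP : idm P @* P = P by rewrite morphim_idm.
  rewrite (eq_bigr (fun y => FiniteModule.fmod abelP x *+ #|<[x]> : P :* y|)%R).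
    rewrite ssralg.GRing.sumrMnr (sum_index_rcosets_cycle sPG Gx trX) -FiniteModule.fmodX /= ?idP //.
    move=> fx0.
    have := congr1 val fx0; rewrite FiniteModule.fmodK /= ?idP ?groupX // => xn1.

    rewrite inE -order_eq1 -dvdn1.
    have /eqP <- : coprime #[x] #|G : P|.
      by apply: pnat_coprime (mem_p_elt pP Px) _; case/and3P: sylP.
    by rewrite dvdn_gcd dvdnn order_dvdn; apply/eqP.
  move=> y _ /=; rewrite -FiniteModule.fmodX //= idP //.
have nsG' : G^`(1) <| G by apply: der_normal.
have := Hall_setI_normal nsG' sylP; rewrite tiPG' => /card_Hall; rewrite cards1 => e1.
by rewrite -partG_eq1 -e1.
Qed.
End Transfer.

(** * Class sizes *)

Section ClassSizes.

Variable gT : finGroupType.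
Implicit Types (G H K M N P Q X Y D : {group gT}) (x y z : gT) (p q u : nat).

Lemma dvdn_class_cent1 G x y :
  'C_G[x] \subset 'C_G[y] -> #|y ^: G| %| #|x ^: G|.
Proof. by move=> sC; rewrite -!index_cent1 indexgS. Qed.

Lemma dvdn_class_constt (pi : nat_pred) G x : #|x.`_pi ^: G| %| #|x ^: G|.
Proof.
apply/dvdn_class_cent1/setIS; rewrite -!cent_cycle centS //.
by rewrite cycle_subG cycle_constt.
Qed.

(** [x] and [y] are the [pi]- and [pi^']-parts of [x * y], hence powers of it. *)
Lemma dvdn_class_mul (pi : nat_pred) G x y :
  pi.-elt x -> pi^'.-elt y -> commute x y ->
  #|x ^: G| %| #|(x * y) ^: G| /\ #|y ^: G| %| #|(x * y) ^: G|.
Proof.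
move=> pi_x pi'y cxy.
have Ex : (x * y).`_pi = x.
  by rewrite consttM // (constt_p_elt pi_x) (constt1P pi'y) mulg1.
have Ey : (x * y).`_pi^' = y.
  rewrite consttM // (constt_p_elt pi'y) (constt1P _) ?mul1g //.
  by rewrite /p_elt pnatNK.
by split; [rewrite -{1}Ex | rewrite -{1}Ey]; apply: dvdn_class_constt.
Qed.

(** With C = C_G(x), the index |N : N :&: C| equals |N C : C|, which divides |G : C|. *)
Lemma dvdn_class_normal N G x :
  N <| G -> x \in G -> #|x ^: N| %| #|x ^: G|.
Proof.
move=> nNG Gx; rewrite -!index_cent1.
have [sNG nNG'] := andP nNG; set C := 'C_G[x].
have sCG : C \subset G by apply: subsetIl.
have nNC : C \subset 'N(N) by apply: subset_trans nNG'.
have -> : 'C_N[x] = N :&: C by rewrite setIA (setIidPl sNG).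
rewrite indexgI -(dvdn_pmul2r (cardG_gt0 C)) LagrangeMr mulnC Lagrange //.
by rewrite -norm_joinEr // cardSg // join_subG sNG.
Qed.

Lemma dvdn_class_quotient N G x :
  N <| G -> x \in G -> #|coset N x ^: (G / N)| %| #|x ^: G|.
Proof.
move=> nNG Gx; have nN := normal_norm nNG.
rewrite -!index_cent1 (@dvdn_trans #|G / N : 'C_G[x] / N|) //.
  rewrite indexgS // quotient_subcent1 //.
by rewrite index_quotient // subIset // nN.
Qed.

Lemma class_conj G x g : g \in G -> (x ^ g) ^: G = x ^: G.
Proof. exact: classGidl. Qed.

Lemma Sylow_cent1 p G P x :
  p.-Sylow(G) P -> x \in G -> p^'.-nat #|x ^: G| ->
  exists2 g, g \in G & P :^ g \subset 'C[x].
Proof.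
move=> sylP Gx p'x; have [R sylR] := Sylow_exists p 'C_G[x].
have sylRG : p.-Sylow(G) R.
  have [sRC pR p'R] := and3P sylR.
  have sRG := subset_trans sRC (subsetIl _ _).
  rewrite /pHall sRG pR -(Lagrange_index (subsetIl G 'C[x]) sRC).
  by rewrite pnatM index_cent1 p'x.
have [g Gg defR] := Sylow_trans sylP sylRG.
by exists g; rewrite // -defR (subset_trans (pHall_sub sylR)) ?subsetIr.
Qed.

(** The dictionary between class sizes and coverings: a class size prime to p means that C_G(x)
    contains a Sylow p-subgroup of G. *)
Lemma class_support_cent p G P x :
  p.-Sylow(G) P -> x \in G ->
  (x \in class_support 'C_G(P) G) = p^'.-nat #|x ^: G|.
Proof.
move=> sylP Gx; apply/idP/idP=> [/class_supportP[g Gg] | p'x].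
  case/setIP=> _ cPx; rewrite -(class_conj _ (groupVr Gg)) -index_cent1.
  have [sPG _] := and3P sylP; apply: pnat_dvd (indexgS _ _) => /=.
  by rewrite subsetI sPG sub_cent1.
have [g Gg sPC] := Sylow_cent1 sylP Gx p'x.
apply/class_supportP; exists g => //; rewrite inE groupJ ?groupV //=.
by rewrite -sub_cent1 cent1J -sub_conjg.
Qed.

(** Lets a factorization G = C K replace conjugation by G with conjugation by K. *)
Lemma class_support_mulr (A : {set gT}) (C K : {group gT}) :
  C \subset 'N(A) -> class_support A (C * K) = class_support A K.
Proof.
move=> nAC; rewrite class_supportM; congr class_support.
apply/setP=> x; apply/class_supportP/idP=> [[g Cg] | Ax].
  by rewrite -mem_conjg (normsP nAC).
by exists 1; rewrite ?group1 // invg1 conjg1.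
Qed.

Lemma central_Sylow p G P :
  p.-Sylow(G) P -> (forall x, x \in G -> p^'.-nat #|x ^: G|) ->
  G \subset 'C(P).
Proof.
move=> sylP p'G; have sCG : 'C_G(P) \subset G by apply: subsetIl.
have [prC | ] := boolP ('C_G(P) \proper G).
  have [x Gx] := class_support_proper prC.
  by rewrite (class_support_cent sylP) ?p'G.
by rewrite properE sCG negbK subsetI subxx.
Qed.

Lemma p_elts_sub K M :
  (forall p x, prime p -> x \in K -> p.-elt x -> x \in M) -> K \subset M.
Proof.
move=> sM; apply/subsetP=> x Kx; rewrite -(prod_constt x).
apply: group_prod => p _; have Kxp : x.`_p \in K.
  by apply: subsetP (cycle_constt p x); rewrite cycle_subG.
have [pr_p | npr_p] := boolP (prime p); first exact: sM (p_elt_constt p x).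
suff -> : x.`_p = 1 by exact: group1.
apply/constt1P; apply/pnatP=> // q pr_q _; rewrite !inE.
by apply: contraNneq npr_p => <-.
Qed.

(** The center contains the Sylow p-subgroups for p <> r, so G / Z(G) is an r-group. *)
Lemma nilpotent_central_p_elts r G :
  (forall p x, prime p -> p != r -> x \in G -> p.-elt x -> x \in 'Z(G)) ->
  nilpotent G.
Proof.
move=> cG; rewrite -quotient_center_nil; apply: (@pgroup_nil _ r).
rewrite /pgroup card_quotient ?normal_norm ?center_normal //.
apply/pnatP=> // p pr_p p_dv; apply: contraLR p_dv => ne_pr.
have [P sylP] := Sylow_exists p G; have [sPG pP p'P] := and3P sylP.
rewrite -p'natE //; apply: pnat_dvd p'P; rewrite indexgS //.
apply/subsetP=> x Px; apply: (cG p) => //; first by rewrite (subsetP sPG).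
exact: mem_p_elt Px.
Qed.

Lemma nilpotent_quotientS G M N :
  G \subset 'N(M) -> G \subset 'N(N) -> M \subset N ->
  nilpotent (G / M) -> nilpotent (G / N).
Proof.
move=> nM nN sMN nilGM; have /homgP[f <-] := homg_quotientS nM nN sMN.
exact: morphim_nil.
Qed.

Lemma class_support_quotient (L A S : {group gT}) x :
  A \subset 'N(L) -> S \subset 'N(L) -> x \in class_support A S ->
  coset L x \in class_support (A / L) (S / L).
Proof.
move=> /subsetP nA /subsetP nS /class_supportP[g Sg Axg].
have nLg : g \in 'N(L) by apply: nS.
have nLx : x \in 'N(L) by have := groupJ (nA _ Axg) nLg; rewrite conjgKV.
apply/class_supportP; exists (coset L g); first exact: mem_quotient.
have -> : coset L x ^ (coset L g)^-1 = coset L (x ^ g^-1).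
  by rewrite morphJ ?groupV // morphV.
exact: mem_quotient.
Qed.

(** Let C be this centralizer and Z = C :&: F(G). The preimage M of F(C / Z) is normal in G, and
    nilpotent because Z is central in C. So M lies in Z, F(C / Z) = 1, and solvability gives C =
    Z. *)
Lemma cent_sub_Fitting G : solvable G -> 'C_G('F(G)) \subset 'F(G).
Proof.
move=> solG; set C := 'C_G('F(G)); set F := 'F(G)%G; pose Z := (C :&: F)%G.
have nCG : C <| G.
  by rewrite /normal subsetIl normsI ?normG ?norms_cent ?gFnorm.
have nZG : Z <| G by apply: normalI (Fitting_normal G).
have nZC : Z <| C by apply: normalS nZG; rewrite ?subsetIl.
pose M := (coset Z @*^-1 'F(C / Z))%G.
have sMC : M \subset C by rewrite sub_cosetpre_quo ?Fitting_sub.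
have nMG : M <| G.
  suff : M <| coset Z @*^-1 (G / Z) by rewrite quotientGK.
  by rewrite cosetpre_normal (char_normal_trans (Fitting_char _)) ?quotient_normal.
have sZM : Z \subset M := normal_sub (normal_cosetpre _).
have nilM : nilpotent M.
  rewrite -quotient_center_nil; apply: (@nilpotent_quotientS _ Z).
  - by rewrite (subset_trans (normal_sub nMG)) ?normal_norm.
  - exact: normal_norm (center_normal _).
  - rewrite subsetI sZM centsC (subset_trans sMC) //.
    by rewrite (subset_trans (subsetIr G _)) // centS ?subsetIr.
  by rewrite cosetpreK Fitting_nil.
have sMZ : M \subset Z by rewrite subsetI sMC Fitting_max.
have : 'F(C / Z) == 1.
  suff : M / Z \subset [1] by rewrite cosetpreK subG1.
  by rewrite quotient_sub1 // (subset_trans sMC) ?normal_norm.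
rewrite trivg_Fitting ?quotient_sol ?(solvableS (subsetIl G _)) //.
rewrite -subG1 quotient_sub1 ?normal_norm // => /subset_trans-> //.
exact: subsetIr.
Qed.

(** A Sylow p-subgroup of C remains Sylow in C L, so a p-element of C L is conjugate into C. This
    lifts coverings obtained modulo L. *)
Lemma p_elt_class_support_join p K (C L : {group gT}) x :
  C \subset K -> L <| K -> p^'.-group L -> p.-elt x ->
  x \in class_support (C <*> L) K -> x \in class_support C K.
Proof.
move=> sCK nLK p'L px /class_supportP[g Kg]; set y := x ^ g^-1 => CLy.
have nLC : C \subset 'N(L) := subset_trans sCK (normal_norm nLK).
have [R sylR] := Sylow_exists p C; have [sRC pR p'R] := and3P sylR.
have sylRCL : p.-Sylow(C <*> L) R.
  rewrite /pHall pR (subset_trans sRC (joing_subl C L)) /=.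
  rewrite -(Lagrange_index (joing_subl C L) sRC) pnatM p'R andbT.
  suff -> : #|C <*> L : C| = #|L : C|.
    by apply: pnat_dvd p'L; rewrite -indexgI dvdn_indexg.
  apply/eqP; rewrite -(eqn_pmul2l (cardG_gt0 C)) (Lagrange (joing_subl C L)).
  by rewrite mulnC LagrangeMr /= joingC norm_joinEr.
have sy : <[y]> \subset C <*> L by rewrite cycle_subG.
have py : p.-group <[y]> by rewrite /pgroup -orderE orderJ.
have [h CLh syR] := Sylow_subJ sylRCL sy py.
have Ch : y ^ h^-1 \in C.
  by rewrite (subsetP sRC) // -mem_conjg -cycle_subG.
apply/class_supportP; exists (h * g); last by rewrite invMg conjgM.
by rewrite groupM // (subsetP _ _ CLh) // join_subG sCK normal_sub.
Qed.

(** With F = F_n, the normal subgroup N F / F of G / F is isomorphic to N / (N :&: F), a quotient of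
    N / M, hence nilpotent. *)
Lemma fitting_series_step G M N n :
  N <| G -> M <| G -> M \subset N -> nilpotent (N / M) ->
  M \subset fitting_series G n -> N \subset fitting_series G n.+1.
Proof.
move=> nNG nMG sMN nilNM sMF.
have nFG := fitting_series_normal G n; set F := fitting_series G n in sMF nFG *.
have sNG := normal_sub nNG.
have nFN : N \subset 'N(F) := subset_trans sNG (normal_norm nFG).
rewrite /= -/F -sub_quotient_pre // Fitting_max ?quotient_normal //.
rewrite -(isog_nil (second_isog nFN)).
apply: (@nilpotent_quotientS _ M) nilNM.
- exact: subset_trans sNG (normal_norm nMG).
- by rewrite normsI ?normG.
by rewrite subsetI sMF.
Qed.

Lemma fitting_height_le3 G M N :
  solvable G -> M <| G -> N <| G -> M \subset N ->
  nilpotent M -> nilpotent (N / M) -> nilpotent (G / N) -> fitting_height G <= 3.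
Proof.
move=> solG nMG nNG sMN nilM nilNM nilGN; have [_ minF] := fitting_heightP solG.
suff sG3 : G \subset fitting_series G 3.
  apply/minF/val_inj/eqP; rewrite eqEsubset sG3 andbT.
  exact: normal_sub (fitting_series_normal G 3).
apply: (fitting_series_step (normal_refl G) nNG (normal_sub nNG) nilGN).
apply: (fitting_series_step nNG nMG sMN nilNM).
apply: (fitting_series_step nMG (normal1 G) (sub1G M)) => //.
by rewrite quotient_nil.
Qed.

End ClassSizes.

(** * Classes of prime power size *)

(** Burnside: nontrivial class sizes of a non-abelian simple group have at least two prime
    divisors. *)
Lemma simple_prime_power_class (gT : finGroupType) (G : {group gT}) (r : nat) x :
  simple G -> x \in G -> x != 1 -> r.-nat #|x ^: G| -> abelian G.
Proof.
move=> simG Gx ntx rx; apply: contraT => nab.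
have /(primes_class_simple_gt1 simG nab) : x ^: G \in (classes G)^#.
  by rewrite !inE classG_eq1 ntx mem_classes.
rewrite ltnNge => /negP[]; rewrite (@uniq_leq_size _ _ [:: r]) ?primes_uniq // => p.
by move/(pnatPpi rx); rewrite !inE.
Qed.

Section PrimePowerClasses.

Variable gT : finGroupType.
Implicit Types (G H K M N P Q W X Y D C : {group gT}) (x y z : gT) (p q r s u : nat).

(** Take N maximal normal in K; it inherits the hypothesis. If a prime p outside {r, s} divides |K /
    N|, a p-element outside N has a nontrivial image of r-power class size, so K / N is abelian;
    otherwise |K / N| has at most two prime divisors. *)
Lemma solvable_prime_power_classes r s K :
  (forall p x, prime p -> p != r -> p != s -> x \in K -> p.-elt x ->
     r.-nat #|x ^: K|) ->
  solvable K.
Proof.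
elim: {K}_.+1 {-2}K (ltnSn #|K|) => // n IHn K leKn rK.
have [-> | ntK] := eqVneq (gval K) 1; first exact: solvable1.
have [N maxN] := ex_maxnormal_ntrivg ntK; have nNK := maxnormal_normal maxN.
have simKN : simple (K / N) by rewrite quotient_simple.
have solN : solvable N.
  apply: IHn => [|p x pr_p p'r p's Nx px].
    exact: leq_trans (proper_card (maxnormal_proper maxN)) leKn.
  have Kx := subsetP (normal_sub nNK) x Nx.
  by apply: pnat_dvd (dvdn_class_normal nNK Kx) (rK _ _ pr_p p'r p's Kx px).
rewrite (series_sol nNK) solN /=.
have [/Burnside_p_a_q_b // | gt2] := leqP (size (primes #|K / N|)) 2.
have /allPn[p p_pi] : ~~ all (mem [:: r; s]) (primes #|K / N|).
  apply: contraL gt2 => /allP sub; rewrite -leqNgt.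
  by rewrite -[2]/(size [:: r; s]) uniq_leq_size ?primes_uniq.
rewrite !inE negb_or => /andP[ne_pr ne_ps].
move: p_pi; rewrite mem_primes => /and3P[pr_p _ p_dv].
have [P sylP] := Sylow_exists p K; have [sPK pP p'P] := and3P sylP.
have /subsetPn[x Px nNx] : ~~ (P \subset N).
  apply: contraL p_dv => sPN; rewrite -p'natE // card_quotient ?normal_norm //.
  by apply: pnat_dvd p'P; rewrite indexgS.
have Kx := subsetP sPK x Px.
apply: abelian_sol; apply: (@simple_prime_power_class _ _ r (coset N x)) => //.
- exact: mem_quotient.
- by apply: contra nNx => /eqP/coset_idr-> //; rewrite (subsetP (normal_norm nNK)).
apply: pnat_dvd (dvdn_class_quotient nNK Kx) _.
exact: rK pr_p ne_pr ne_ps Kx (mem_p_elt pP Px).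
Qed.

(* Choosing M / W chief in K with K = CM and CW < K, the hypothesis and Burnside's theorem
   on simple groups force M / W to be abelian, whence W <= CW :&: M <| M and an element of M
   outside CW has a primary part outside CW. *)
Lemma exists_p_elt_notin_class_support r K C X :
  C \subset K -> (forall x, x \in K -> x \notin class_support C K -> r.-nat #|x ^: K|) ->
  X <| K -> ~~ (K \subset C <*> X) ->
  exists p y, [/\ prime p, y \in K, p.-elt y & y \notin class_support (C <*> X) K].
Proof.
move=> sCK rK nXK nKCX.
pose gW := fun W : {group gT} => (W <| K) && ~~ (K \subset C <*> W).
have [W /maxgroupP[/andP[nWK nKCW] maxW] sXW] : {W : {group gT} | maxgroup W gW & X \subset W}.
  by apply: maxgroup_exists; rewrite /gW nXK.
have sWK := normal_sub nWK; have sCW_K : C <*> W \subset K by rewrite join_subG sCK.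
pose gM := fun M : {group gT} => [&& M <| K, W \subset M & ~~ (M \subset W)].
have [M /mingroupP[/and3P[nMK sWM nMW] minM] _] : {M : {group gT} | mingroup M gM & M \subset K}.
  apply: mingroup_exists; rewrite /gM normal_refl sWK.
  by apply: contra nKCW => /subset_trans-> //; apply: joing_subr.
have sMK := normal_sub nMK.
have sKCM : K \subset C <*> M.
  apply: contraR nMW => nKCM; rewrite -(maxW M) // /gW.
  by rewrite nMK.
have defK : C * M = K.
  rewrite -norm_joinEl ?(subset_trans sCK) ?normal_norm //; apply/eqP.
  by rewrite eqEsubset sKCM join_subG sCK sMK.
pose D := ((C <*> W) :&: M)%G.
have sDM : D \subset M by apply: subsetIr.
have sWD : W \subset D by rewrite subsetI sWM joing_subr.
have prD : D \proper M.
  rewrite properE sDM; apply: contra nKCW; rewrite subsetI => /andP[sMCW _].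
  by rewrite (subset_trans sKCM) // join_subG joing_subl.
have csD x : x \in M -> x \in class_support (C <*> W) K -> x \in class_support D M.
  move=> Mx; rewrite -defK class_support_mulr; last first.
    by rewrite (subset_trans (joing_subl C W)) ?normG.
  case/class_supportP=> g Mg CWx; apply/class_supportP; exists g => //.
  by rewrite inE CWx groupJ ?groupV.
(* [m] avoids the M-conjugates of D, hence the K-conjugates of C, so its class size in K is an
   r-power. *)
have [m Mm csm] := class_support_proper prD.
have Km := subsetP sMK m Mm.
have rm : r.-nat #|m ^: K|.
  apply: rK => //; apply: contra csm => csm; apply: csD => //.
  by apply: subsetP csm; apply: class_supportS; rewrite ?joing_subl.
have nWm : m \notin W.
  by apply: contra csm => Wm; rewrite mem_class_support // (subsetP sWD).
(* Otherwise M = W M'. For N maximal normal in M over W, the K-core of N lies in W by minimality of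
   M, so some K-conjugate of [m] has a nontrivial image in the simple group M / N, with r-power
   class size. Then M / N is abelian and N contains W M' = M. *)
have sM'W : M^`(1) \subset W.
  apply: contraT => nM'W.
  have defM : (W <*> M^`(1))%G = M.
    apply/val_inj/minM; last by rewrite join_subG sWM der_sub.
    rewrite /gM normalY ?(char_normal_trans (der_char 1 M)) //= joing_subl.
    by apply: contra nM'W => /(subset_trans (joing_subr _ _)).
  pose gN := fun N : {group gT} => (N \proper M) && (M \subset 'N(N)).
  have [N maxN sWN] : {N : {group gT} | maxgroup N gN & W \subset N}.
    apply: maxgroup_exists; rewrite /gN properE sWM nMW /=.
    by rewrite (subset_trans sMK) ?normal_norm.
  have nNM : N <| M := maxnormal_normal maxN.
  have prN : N \proper M := maxnormal_proper maxN.
  have sNM := normal_sub nNM.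
  have sgW : gcore N K \subset W.
    apply: contraLR (proper_subn prN) => ngW; rewrite negbK.
    have <- : gcore N K = M.
      apply: (minM (gcore_group N K)); last exact: subset_trans (gcore_sub _ _) sNM.
      rewrite /gM ngW gcore_normal ?(subset_trans sNM) //= andbT.
      by rewrite gcore_max // normal_norm.
    exact: gcore_sub.
  have [g Kg nNmg] : exists2 g, g \in K & m ^ g \notin N.
    have := contra (subsetP sgW m) nWm; rewrite /gcore => /bigcapP nbig.
    apply/exists_inP; rewrite -negb_forall_in; apply/negP=> /forall_inP allN.
    by case: nbig => g Kg; rewrite mem_conjg allN ?groupV.
  have Mmg : m ^ g \in M by rewrite memJ_norm // (subsetP (normal_norm nMK)).
  case/negP: (proper_subn prN); rewrite -{1}defM join_subG sWN /=.
  apply: der1_min; first exact: normal_norm.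
  apply: (@simple_prime_power_class _ _ r (coset N (m ^ g))).
  - by rewrite quotient_simple.
  - exact: mem_quotient.
  - by apply: contra nNmg => /eqP/coset_idr-> //; rewrite (subsetP (normal_norm nNM)).
  apply: pnat_dvd (dvdn_class_quotient nNM Mmg) _.
  apply: pnat_dvd (dvdn_class_normal nMK _) _; first by rewrite groupJ.
  by rewrite class_conj.
(* D contains M', so its M-conjugates add nothing, and a primary part of [m] outside D suffices. *)
have nDM : D <| M by apply: sub_der1_normal; rewrite ?(subset_trans sM'W).
have csDD : class_support D M \subset D.
  by rewrite class_support_sub_norm // normal_norm.
have [p pr_p nDmp] : exists2 p, prime p & m.`_p \notin D.
  have nDm : m \notin D by apply: contra csm; apply: mem_class_support.
  have /existsP[p /andP[_ nDmp]] :
      [exists p : 'I_#[m].+1, true && (m.`_p \notin D)].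
    apply: contraR nDm; rewrite negb_exists => /forallP allD.
    rewrite -(prod_constt m) big_mkord; apply: group_prod => p _.
    by have := allD p; rewrite negbK.
  exists p => //; apply: contraR nDmp => npr_p.
  suff -> : m.`_p = 1 by exact: group1.
  apply/constt1P; apply/pnatP=> // q pr_q _; rewrite !inE.
  by apply: contraNneq npr_p => <-.
exists p, m.`_p; split; rewrite ?p_elt_constt //.
  by apply: subsetP (cycle_constt p m); rewrite cycle_subG.
have Mmp : m.`_p \in M by apply: subsetP (cycle_constt p m); rewrite cycle_subG.
apply: contra nDmp => csmp; apply: (subsetP csDD); apply: csD => //.
apply: subsetP csmp; apply: class_supportS => //.
by rewrite join_subG joing_subl (subset_trans sXW) ?joing_subr.
Qed.

End PrimePowerClasses.

(** * Separated class sizes *)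

Section Separation.

Variable gT : finGroupType.
Implicit Types (G H K L M N P Q R T U W X Y D C : {group gT}) (x y z g : gT).
Implicit Types (A B : nat_pred) (a b p q r s u : nat).

Definition class_prime G p := prime p /\ exists2 x, x \in G & p %| #|x ^: G|.

(* Only meaningful for p != q: class_edge G p p just says that p divides a class size. *)
Definition class_edge G p q :=
  exists2 x, x \in G & (p %| #|x ^: G|) && (q %| #|x ^: G|).

(** The two sides of Delta(G) - r are predicates on numbers, so that [A^'.-nat] and ['O_A^'(G)]
    apply to them. [sep_class] says, one class size at a time, that no edge joins the sides. *)
Record separation G A B r : Prop := Separation {
  sep_prime : forall p, (p \in A) || (p \in B) -> class_prime G p;
  sep_cover : forall p, class_prime G p -> [|| p \in A, p \in B | p == r];
  sep_neqA : r \notin A;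
  sep_neqB : r \notin B;
  sep_disjoint : forall p, p \in A -> p \notin B;
  sep_class : forall x, x \in G -> A^'.-nat #|x ^: G| \/ B^'.-nat #|x ^: G|
}.

Lemma separation_sym G A B r : separation G A B r -> separation G B A r.
Proof.
case=> prV cov nA nB dAB sep; split=> //.
- by move=> p; rewrite orbC; apply: prV.
- by move=> p /cov; rewrite orbCA.
- by move=> p Bp; apply: contraL Bp; apply: dAB.
- by move=> x /sep[]; [right | left].
Qed.

(** Burnside's condition for a normal p-complement. *)
Definition central_Sylows G p :=
  forall P, p.-Sylow(G) P -> 'N_G(P) \subset 'C(P).

Lemma nonadjacent_central_Sylows G p q :
  prime p -> prime q -> ~ class_edge G p q ->
  central_Sylows G p \/ central_Sylows G q.
Proof.
move=> pr_p pr_q npq.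
have conj u P : 'N_G(P) \subset 'C(P) -> u.-Sylow(G) P -> central_Sylows G u.
  move=> cNP sylP Q sylQ; have [g Gg ->] := Sylow_trans sylP sylQ.
  by rewrite normJ centJ -{1}(conjGid Gg) -conjIg conjSg.
have [P sylP] := Sylow_exists p G; have [Q sylQ] := Sylow_exists q G.
have [|cNP|cNQ] := cover_centralizers (pHall_sub sylP) (pHall_sub sylQ).
- apply/subsetP=> x Gx; rewrite inE (class_support_cent sylP) // (class_support_cent sylQ) //.
  rewrite !p'natE // -negb_and; apply/negP=> pq_x; by case: npq; exists x.
- by left; apply: conj cNP sylP.
by right; apply: conj cNQ sylQ.
Qed.

Lemma class_p'nat_cent p G P x :
  p.-Sylow(G) P -> P \subset 'C[x] -> p^'.-nat #|x ^: G|.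
Proof.
move=> sylP cPx; have [sPG _ p'P] := and3P sylP.
by rewrite -index_cent1; apply: pnat_dvd p'P; rewrite indexgS // subsetI sPG.
Qed.

Lemma p_elt_commute p G x y :
  x \in G -> p^'.-nat #|x ^: G| -> y \in G -> p.-elt y ->
  exists2 g, g \in G & commute x (y ^ g).
Proof.
move=> Gx p'x Gy p_y; have sy : <[y]> \subset G by rewrite cycle_subG.
have [P sylP Py] := Sylow_superset sy p_y.
have [g Gg /subsetP sPC] := Sylow_cent1 sylP Gx p'x.
exists g => //; apply: commute_sym; apply/cent1P/sPC; rewrite memJ_conjg.
by rewrite (subsetP Py) ?cycle_id.
Qed.

Lemma class_prime_noncentral p G P :
  class_prime G p -> p.-Sylow(G) P -> ~~ (G \subset 'C(P)).
Proof.
case=> pr_p [x Gx px] sylP; apply: contraL px => /subsetP cG.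
by rewrite -p'natE // (class_p'nat_cent sylP) // sub_cent1 cG.
Qed.

End Separation.

(** * The subgroup K when N_G(P) = C_G(P) for all primes of A *)

Section Residual.

Variables (gT : finGroupType) (G : {group gT}) (A B : nat_pred) (r : nat).
Implicit Types (P Q R T X Y D C : {group gT}) (x y z g : gT) (a b p q s u : nat).
Hypotheses (sepG : separation G A B r) (cSA : forall p, p \in A -> central_Sylows G p).

Local Notation K := ('O_A^'(G))%G.

Lemma prime_sepA p : p \in A -> prime p.
Proof. by move=> Ap; have [] := sep_prime sepG (_ : (p \in A) || (p \in B)); rewrite ?Ap. Qed.

Lemma prime_sepB p : p \in B -> prime p.
Proof. by move=> Bp; have [] := sep_prime sepG (_ : (p \in A) || (p \in B)); rewrite ?Bp ?orbT. Qed.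

Lemma class_primeA p : p \in A -> class_prime G p.
Proof. by move=> Ap; apply: (sep_prime sepG); rewrite Ap. Qed.

Lemma class_primeB p : p \in B -> class_prime G p.
Proof. by move=> Bp; apply: (sep_prime sepG); rewrite Bp orbT. Qed.

Lemma res_normal : K <| G. Proof. exact: pcore_normal. Qed.

Lemma res_sub : K \subset G. Proof. exact: pcore_sub. Qed.

Lemma res_pgroup : A^'.-group K. Proof. exact: pcore_pgroup. Qed.

Lemma der1_sub_res : G^`(1) \subset K.
Proof.
apply: pcore_max (der_normal 1 G).
apply/pnatP=> // p pr_p p_dv; apply: contraL p_dv => Ap.
have [P sylP] := Sylow_exists p G.
by rewrite -p'natE //; apply: Burnside_transfer sylP (cSA Ap sylP).
Qed.

(** [K <*> <[x]>] is normal because it contains G', and it is an A'-group, so it lies in K. *)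
Lemma p_elt_res u x : u \notin A -> x \in G -> u.-elt x -> x \in K.
Proof.
move=> nAu Gx ux; have sKx : <[x]> \subset G by rewrite cycle_subG.
have nKx : <[x]> \subset 'N(K) by rewrite (subset_trans sKx) ?normal_norm ?res_normal.
rewrite -cycle_subG (subset_trans (joing_subr K _)) // pcore_max //=.
  rewrite norm_joinEr // pgroupM res_pgroup /=.
  by apply: sub_in_pnat ux => v _; rewrite !inE => /eqP->.
apply: sub_der1_normal; last by rewrite join_subG res_sub.
by rewrite (subset_trans der1_sub_res) ?joing_subl.
Qed.

(** [K <*> P] contains G', hence is normal, and the Frattini argument gives G = K N_G(P) = K
    C_G(P). *)
Lemma res_cent p P : p \in A -> p.-Sylow(G) P -> 'C_G(P) * K = G.
Proof.
move=> Ap sylP; have sPG := pHall_sub sylP.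
have nPK : P \subset 'N(K) by rewrite (subset_trans sPG) ?normal_norm ?res_normal.
have nKP : K <*> P <| G.
  apply: sub_der1_normal; last by rewrite join_subG res_sub.
  by rewrite (subset_trans der1_sub_res) ?joing_subl.
have sylKP : p.-Sylow(K <*> P) P by rewrite (pHall_subl _ _ sylP) ?joing_subr ?normal_sub.
have := Frattini_arg nKP sylKP; rewrite /= norm_joinEr // -mulgA.
rewrite (mulSGid (_ : P \subset 'N_G(P))); last by rewrite subsetI sPG normG.
have sNC : 'N_G(P) \subset 'C_G(P) by rewrite subsetI subsetIl (cSA Ap sylP).
have nKC : 'C_G(P) \subset 'N(K) by rewrite subIset // normal_norm ?res_normal.
move=> defG; apply/eqP; rewrite eqEsubset mul_subG ?subsetIl ?res_sub //=.
by rewrite (normC nKC) (subset_trans _ (mulgS _ sNC)) ?defG.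
Qed.

(** As G = C_G(P) K, conjugation by K reaches all conjugates of C_G(P); divisibility of G-class
    sizes by p is thus read off inside K. *)
Lemma class_support_res p P x : p \in A -> p.-Sylow(G) P -> x \in K ->
  (x \in class_support 'C_K(P) K) = p^'.-nat #|x ^: G|.
Proof.
move=> Ap sylP Kx; rewrite -(class_support_cent sylP) ?(subsetP res_sub) //.
have -> : class_support 'C_G(P) G = class_support 'C_G(P) K.
  by rewrite -[X in class_support _ X = _](res_cent Ap sylP) class_support_mulr ?normG.
apply/idP/idP; first by apply/subsetP/class_supportS; rewrite ?setSI ?res_sub.
case/class_supportP=> g Kg /setIP[_ cP]; apply/class_supportP; exists g => //.
by rewrite inE groupJ ?groupV.
Qed.

Lemma res_noncentral p P : p \in A -> p.-Sylow(G) P -> ~~ (K \subset 'C(P)).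
Proof.
move=> Ap sylP; apply: contra (class_prime_noncentral (class_primeA Ap) sylP) => cK.
by rewrite -(res_cent Ap sylP) mul_subG ?subsetIr.
Qed.

Lemma classA_B' p x : p \in A -> x \in G -> ~~ p^'.-nat #|x ^: G| -> B^'.-nat #|x ^: G|.
Proof.
move=> Ap Gx px; have [A'x | //] := sep_class sepG Gx.
by case/negP: px; apply: pi'_p'nat A'x _.
Qed.

(** The size divides |K|, which excludes A; it divides a G-class size divisible by p, which excludes
    B; only r remains. *)
Lemma classA_r p x : p \in A -> x \in K -> ~~ p^'.-nat #|x ^: G| -> r.-nat #|x ^: K|.
Proof.
move=> Ap Kx px; have Gx := subsetP res_sub x Kx.
have dvKG := dvdn_class_normal res_normal Gx.
have B'x := classA_B' Ap Gx px.
have A'x : A^'.-nat #|x ^: K|.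
  by apply: pnat_dvd res_pgroup; rewrite -index_cent1 dvdn_indexg.
have gt0 (H : {group gT}) : 0 < #|x ^: H| by rewrite -index_cent1 indexg_gt0.
apply/pnatP=> // q pr_q q_dv.
have /(sep_cover sepG) : class_prime G q.
  by split=> //; exists x => //; apply: dvdn_trans q_dv dvKG.
have qpi n : 0 < n -> q %| n -> q \in \pi(n) by rewrite [_ \in \pi(_)]mem_primes pr_q => -> ->.
case/or3P=> [Aq | Bq | //].
  by have := pnatPpi A'x (qpi _ (gt0 _) q_dv); rewrite !inE Aq.
have := pnatPpi B'x (qpi _ (gt0 _) (dvdn_trans q_dv dvKG)).
by rewrite !inE Bq.
Qed.

Lemma exists_p_elt_classA p P X : p \in A -> p.-Sylow(G) P -> X <| K ->
  ~~ (K \subset 'C_K(P) <*> X) ->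
  exists s y, [/\ prime s, y \in K, s.-elt y,
    y \notin class_support ('C_K(P) <*> X) K & ~~ p^'.-nat #|y ^: G|].
Proof.
move=> Ap sylP nXK nKCX.
have [|s [y [pr_s Ky sy csy]]] :=
    @exists_p_elt_notin_class_support _ r K 'C_K(P)%G X (subsetIl _ _) _ nXK nKCX.
  by move=> x Kx; rewrite (class_support_res Ap sylP Kx); apply: classA_r Ap Kx.
exists s, y; split=> //; rewrite -(class_support_res Ap sylP Ky).
apply: contra csy; apply/subsetP/class_supportS => //; exact: joing_subl.
Qed.

(** [u] is not a vertex of Delta(G), so its Sylow subgroups are central. *)
Lemma central_p_elt u x : prime u -> u \notin A -> u \notin B -> u != r ->
  x \in G -> u.-elt x -> x \in 'Z(G).
Proof.
move=> pr_u nAu nBu nur Gx ux; have sx : <[x]> \subset G by rewrite cycle_subG.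
have [P sylP sxP] := Sylow_superset sx ux.
have u'G y : y \in G -> u^'.-nat #|y ^: G|.
  move=> Gy; rewrite p'natE //; apply/negP=> uy.
  have /(sep_cover sepG) : class_prime G u by split=> //; exists y.
  by rewrite (negPf nAu) (negPf nBu) (negPf nur).
rewrite inE Gx -sub_cent1 (subset_trans (central_Sylow sylP u'G)) //.
by rewrite -cent_cycle centS.
Qed.

(* A product of commuting elements of coprime orders has a class size divisible by those of
   its factors, so x inherits the restrictions imposed on y * x ^ g by the presence of p. *)
Lemma classA_commute p s u y x : p \in A -> u != s -> y \in K -> s.-elt y ->
  ~~ p^'.-nat #|y ^: G| -> u^'.-nat #|y ^: K| -> x \in K -> u.-elt x ->
  r.-nat #|x ^: K|.
Proof.
move=> Ap nus Ky sy py u'y Kx ux.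
have [g Kg cyx] := p_elt_commute Ky u'y Kx ux.
have s'x : s^'.-elt (x ^ g).
  by rewrite p_eltJ; apply: sub_in_pnat ux => v _; rewrite !inE => /eqP->.
have Kyx : y * x ^ g \in K by rewrite groupM ?groupJ.
rewrite -(class_conj x Kg); apply: pnat_dvd (dvdn_class_mul K sy s'x cyx).2 _.
apply: (classA_r Ap Kyx); apply: contra py.
by apply: pnat_dvd (dvdn_class_mul G sy s'x cyx).1.
Qed.

Lemma res_class_B' x : B^'.-nat #|x ^: G| -> x \in K -> B^'.-nat #|x ^: K|.
Proof.
move=> B'x Kx; apply: pnat_dvd B'x; apply: dvdn_class_normal res_normal _.
exact: subsetP res_sub x Kx.
Qed.

Lemma r_nat_B' n : r.-nat n -> B^'.-nat n.
Proof.
apply: sub_in_pnat => v _; rewrite !inE => /eqP->; exact: sep_neqB sepG.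
Qed.

Lemma res_p'elt p x : p \in A -> x \in K -> p.-elt x -> x = 1.
Proof.
move=> Ap Kx px; apply/eqP; rewrite -order_eq1.
rewrite -(part_pnat_id px) part_p'nat //.
by apply: pi'_p'nat (mem_p_elt res_pgroup Kx) _.
Qed.

Hypothesis (ntA : exists p, p \in A).

Lemma p_elt_classB u s y p x : p \in A -> u != s -> y \in K -> s.-elt y ->
  ~~ p^'.-nat #|y ^: G| -> u \in B -> x \in K -> u.-elt x -> r.-nat #|x ^: K|.
Proof.
move=> Ap nus Ky sy py Bu; apply: (classA_commute Ap nus Ky sy py).
have B'y := res_class_B' (classA_B' Ap (subsetP res_sub y Ky) py) Ky.
by apply: pi'_p'nat B'y _.
Qed.

(** Let [y] be an s-element of K with class size divisible by a prime of A. For primes other than r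
    and s, primary elements of K are trivial (primes of A), have a conjugate commuting with [y] and
    hence an r-power class (primes of B), or are central. *)
Lemma res_solvable : solvable K.
Proof.
have [p Ap] := ntA; have [P sylP] := Sylow_exists p G.
have [|s [y [pr_s Ky sy _ py]]] := exists_p_elt_classA Ap sylP (normal1 K).
  rewrite joingG1 subsetI subxx; exact: res_noncentral sylP.
apply: (@solvable_prime_power_classes _ r s) => u x pr_u nur nus Kx ux.
have [Au | nAu] := boolP (u \in A).
  by rewrite (res_p'elt Au Kx ux) class1G cards1.
have [Bu | nBu] := boolP (u \in B); first exact: p_elt_classB Ap nus Ky sy py Bu Kx ux.
have Gx := subsetP res_sub x Kx.
have /setIP[_ cx] := central_p_elt pr_u nAu nBu nur Gx ux.
rewrite -index_cent1 (_ : 'C_K[x] = K) ?indexgg //; apply/setIidPl.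
by rewrite sub_cent1 (subsetP (centS res_sub)).
Qed.

Lemma sep_solvable : solvable G.
Proof.
rewrite (series_sol res_normal) res_solvable abelian_sol //.
by rewrite sub_der1_abelian ?der1_sub_res.
Qed.

(** * The series U <= N <= G and the Fitting height *)

Local Notation U := ('O_B^'(K))%G.
Local Notation N := (coset U @*^-1 'F(K / U))%G.

Lemma coreU_normal : U <| G.
Proof. exact: char_normal_trans (pcore_char _ _) res_normal. Qed.

Lemma coreU_normal_res : U <| K. Proof. exact: pcore_normal. Qed.

Lemma coreN_normal : N <| G.
Proof.
suff : N <| coset U @*^-1 (G / U) by rewrite quotientGK ?coreU_normal.
rewrite cosetpre_normal.
exact: char_normal_trans (Fitting_char _) (quotient_normal _ res_normal).
Qed.

Lemma coreN_sub : N \subset K.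
Proof. by rewrite sub_cosetpre_quo ?coreU_normal_res ?Fitting_sub. Qed.

Lemma coreN_normal_res : N <| K.
Proof. exact: normalS coreN_sub res_sub coreN_normal. Qed.

Lemma coreU_sub : U \subset N.
Proof. exact: normal_sub (normal_cosetpre _). Qed.

Lemma coreN_nil : nilpotent (N / U).
Proof. by rewrite cosetpreK Fitting_nil. Qed.

(** For primes other than r, the primary elements of [X] are trivial (primes of A or B) or central
    in G. *)
Lemma nilpotent_joinU X : U \subset X -> X \subset K ->
  (forall b x, b \in B -> x \in X -> b.-elt x -> x = 1) -> nilpotent X.
Proof.
move=> sUX sXK BX; apply: (@nilpotent_central_p_elts _ r) => u x pr_u nur Xx ux.
have Kx := subsetP sXK x Xx.
have [Au | nAu] := boolP (u \in A); first by rewrite (res_p'elt Au Kx ux) group1.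
have [Bu | nBu] := boolP (u \in B); first by rewrite (BX u x) ?group1.
have /setIP[_ cx] := central_p_elt pr_u nAu nBu nur (subsetP res_sub x Kx) ux.
by rewrite inE Xx (subsetP (centS (subset_trans sXK res_sub))).
Qed.

Lemma coreU_p'elt b x : b \in B -> x \in U -> b.-elt x -> x = 1.
Proof.
move=> Bb Ux bx; apply/eqP; rewrite -order_eq1 -(part_pnat_id bx) part_p'nat //.
by apply: pi'_p'nat (mem_p_elt (pcore_pgroup _ _) Ux) _.
Qed.

Lemma coreU_nil : nilpotent U.
Proof. apply: nilpotent_joinU (normal_sub coreU_normal_res) _ => //; exact: coreU_p'elt. Qed.

(** K / U has no nontrivial normal B'-subgroup, so F(K / U) is a B-group. *)
Lemma fit_coreU_1 p f : p \notin B -> f \in 'F(K / U) -> p.-elt f -> f = 1.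
Proof.
move=> nBp Ff pf; have /trivgP sub1 : 'O_p(K / U) \subset [1].
  rewrite -(trivg_pcore_quotient B^' K) pcore_max ?pcore_normal //.
  by apply: sub_in_pnat (pcore_pgroup p (K / U)) => v _; rewrite !inE => /eqP->.
have : f \in 'O_p('F(K / U)).
  by rewrite (mem_normal_Hall (nilpotent_pcore_Hall _ (Fitting_nil _)) (pcore_normal _ _)).
by rewrite p_core_Fitting sub1 => /set1P.
Qed.

(** For p in B the image of [x] centralizes a Sylow p-subgroup of K / U, hence O_p(K / U). These
    generate F(K / U), which contains its own centralizer. *)
Lemma mem_coreN x : x \in K -> B^'.-nat #|x ^: K| -> x \in N.
Proof.
move=> Kx B'x; have nUK := normal_norm coreU_normal_res.
have nUx := subsetP nUK x Kx.
rewrite mem_morphpre //=.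
have solKU : solvable (K / U) by rewrite quotient_sol ?res_solvable.
apply: (subsetP (cent_sub_Fitting solKU)); rewrite inE mem_quotient //= -sub_cent1.
apply: p_elts_sub => p f pr_p Ff pf.
have [Bp | nBp] := boolP (p \in B); last by rewrite (fit_coreU_1 nBp Ff pf) group1.
have Opf : f \in 'O_p(K / U).
  rewrite -p_core_Fitting (mem_normal_Hall (nilpotent_pcore_Hall _ _) (pcore_normal _ _)) //.
  exact: Fitting_nil.
have p'xb : p^'.-nat #|coset U x ^: (K / U)|.
  apply: pnat_dvd (dvdn_class_quotient coreU_normal_res Kx) _.
  by apply: pi'_p'nat B'x _.
have [P sylP] := Sylow_exists p (K / U).
have [g Kg sPC] := Sylow_cent1 sylP (mem_quotient U Kx) p'xb.
by rewrite (subsetP sPC) // (subsetP (pcore_sub_Hall _) _ Opf) // pHallJ.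
Qed.

(** Outside N a class size has a prime of B, hence none of A, so the element lies in a conjugate of
    C_K(P): the conjugates of C_K(P) N cover K. *)
Lemma res_cent_coreN p P : p \in A -> p.-Sylow(G) P -> K \subset 'C_K(P) <*> N.
Proof.
move=> Ap sylP; apply: contraT => nKCN.
have prCN : 'C_K(P) <*> N \proper K.
  by rewrite properE nKCN andbT join_subG subsetIl coreN_sub.
have [x Kx csx] := class_support_proper prCN.
case/negP: csx; have [Nx | nNx] := boolP (x \in N).
  by apply: mem_class_support; apply: (subsetP (joing_subr _ _)).
have [A'x | B'x] := sep_class sepG (subsetP res_sub x Kx); last first.
  by case/negP: nNx; rewrite mem_coreN ?res_class_B'.
have : x \in class_support 'C_K(P) K.
  rewrite (class_support_res Ap sylP Kx).
  by apply: pi'_p'nat A'x _.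
by apply/subsetP/class_supportS; rewrite ?joing_subl.
Qed.

Lemma res_coreN p P : p \in A -> p.-Sylow(G) P -> 'C_K(P) * N = K.
Proof.
move=> Ap sylP; apply/eqP; rewrite eqEsubset mul_subG ?subsetIl ?coreN_sub //=.
have := res_cent_coreN Ap sylP; rewrite norm_joinEl //.
by rewrite (subset_trans (subsetIl _ _)) ?normal_norm ?coreN_normal_res.
Qed.

(* For b != s all b-elements have classes of r-power size.  For b = s, if a Sylow b-subgroup T
   is not inside N, then modulo O_{b'}(N) it is covered by N and the conjugates of its
   intersection with C_K(P), hence centralized by P, against the choice of y. *)
Lemma p_elt_coreN b x : b \in B -> x \in K -> b.-elt x -> x \in N.
Proof.
move=> Bb Kx bx; have [p Ap] := ntA; have [P sylP] := Sylow_exists p G.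
have [|s [y [pr_s Ky sy csy py]]] := exists_p_elt_classA Ap sylP (normal1 K).
  rewrite joingG1 subsetI subxx; exact: res_noncentral sylP.
have [Ebs | nbs] := eqVneq b s; last first.
  rewrite mem_coreN // r_nat_B' //.
  exact: p_elt_classB Ap nbs Ky sy py Bb Kx bx.
apply: contraR csy => nNx; rewrite joingG1.
(* L contains U, and modulo L the nilpotent group N / U keeps only its b-part, so N / L is a normal
   b-subgroup of K / L. *)
pose L := 'O_b^'(N)%G.
have nLN : L <| N := pcore_normal _ _.
have nLK : L <| K := char_normal_trans (pcore_char _ _) coreN_normal_res.
have sLK := normal_sub nLK; have nLK' := normal_norm nLK.
have sLN := normal_sub nLN.
have sUL : U \subset L.
  apply: pcore_max; last exact: normalS coreU_sub coreN_sub coreU_normal_res.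
  by apply: pi'_p'nat (pcore_pgroup _ _) _.
have nUN : U <| N := normalS coreU_sub coreN_sub coreU_normal_res.
have bNL : b.-group (N / L).
  rewrite /pgroup card_quotient ?(subset_trans coreN_sub) //.
  rewrite -(index_quotient_eq _ sLN (normal_norm nUN)); last by rewrite subIset // sUL orbT.
  have b'U : b^'.-group U by apply: pgroupS sUL (pcore_pgroup _ _).
  rewrite -(pquotient_pcore nUN b'U) -(pnatNK b).
  by case/and3P: (nilpotent_pcore_Hall b^' coreN_nil).
have sx : <[x]> \subset K by rewrite cycle_subG.
have [T sylT sxT] := Sylow_superset sx bx.
have Tx : x \in T by rewrite -cycle_subG.
have sTK := pHall_sub sylT.
have sylTL : b.-Sylow(K / L) (T / L) := quotient_pHall (subset_trans sTK nLK') sylT.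
have sNT : N / L \subset T / L.
  apply: subset_trans (pcore_sub_Hall sylTL); apply: pcore_max => //.
  exact: quotient_normal coreN_normal_res.
pose D := (T / L :&: 'C_K(P) / L)%G.
have [||||/= defD|/= defN] := @nilpotent_cover _ (T / L)%G D (N / L)%G.
- exact: pgroup_nil (pHall_pgroup sylTL).
- exact: subsetIl.
- exact: sNT.
- apply/subsetP=> _ /morphimP[t _ Tt ->]; rewrite inE; apply/orP.
  have [Nt | nNt] := boolP (t \in N).
    by right; apply: mem_class_support; apply: mem_quotient.
  left; have Kt := subsetP sTK t Tt.
  have : t \in class_support 'C_K(P) K.
    rewrite (class_support_res Ap sylP Kt).
    have [A't | B't] := sep_class sepG (subsetP res_sub t Kt); last first.
      by case/negP: nNt; rewrite mem_coreN ?res_class_B'.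
    by apply: pi'_p'nat A't _.
  (* K = C_K(P) N lets the conjugating element be taken in N, whose image lies in T / L, so the
     covering takes place inside T / L. *)
  rewrite -[X in class_support _ X](res_coreN Ap sylP).
  rewrite (@class_support_mulr _ _ 'C_K(P)%G N) ?normG //.
  case/class_supportP=> n Nn Ct.
  have nLn : n \in 'N(L) by rewrite (subsetP nLK') // (subsetP coreN_sub).
  have nLt : t \in 'N(L) by rewrite (subsetP nLK').
  have NLn : coset L n \in T / L by rewrite (subsetP sNT) // mem_quotient.
  apply/class_supportP; exists (coset L n) => //.
  have tnE : coset L t ^ (coset L n)^-1 = coset L (t ^ n^-1).
    by rewrite morphJ ?groupV // morphV.
  have nTt : coset L t ^ (coset L n)^-1 \in T / L.
    by rewrite groupJ ?groupV // mem_quotient.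
  by rewrite inE nTt tnE mem_quotient.
- have sylTC : T \subset 'C_K(P) <*> L.
    have : T / L \subset 'C_K(P) / L by rewrite -defD subsetIr.
    rewrite quotientSK ?(subset_trans sTK nLK') // => /subset_trans-> //.
    by rewrite mul_subG ?joing_subl ?joing_subr.
  apply: (@p_elt_class_support_join _ s K 'C_K(P)%G L) => //; rewrite -?Ebs ?subsetIl ?pcore_pgroup //.
  have sy' : <[y]> \subset K by rewrite cycle_subG.
  have by_ : b.-group <[y]> by rewrite Ebs.
  have [g Kg syT] := Sylow_subJ sylT sy' by_.
  apply/class_supportP; exists g => //; rewrite (subsetP sylTC) //.
  by rewrite -mem_conjg -cycle_subG.
case/negP: nNx; have : x \in coset L @*^-1 (N / L).
  by rewrite mem_morphpre ?(subsetP nLK') //= defN mem_quotient.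
by rewrite quotientGK.
Qed.

(** G = C_G(P) N makes the image of P central for primes of A, b-elements with b in B lie in N, and
    primes that are not vertices give central elements; only r remains. *)
Lemma quotient_coreN_nil : nilpotent (G / N).
Proof.
have nNG := normal_norm coreN_normal.
apply: (@nilpotent_central_p_elts _ r) => u xb pr_u nur /morphimP[x0 nNx0 Gx0 ->] ux0.
(* The [u]-part of the representative has the same image and is a [u]-element of [G] itself. *)
set x := x0.`_u; have Gx : x \in G.
  by apply: subsetP (cycle_constt u x0); rewrite cycle_subG.
have ux : u.-elt x := p_elt_constt u x0.
have -> : coset_morphism N x0 = coset N x.
  by rewrite /x morph_constt // constt_p_elt.
have [Au | nAu] := boolP (u \in A).
  have sx : <[x]> \subset G by rewrite cycle_subG.
  have [P sylP sxP] := Sylow_superset sx ux.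
  rewrite inE mem_quotient //= -sub_cent1.
  have sGCN : G \subset 'C_G(P) * N.
    have sKCN : K \subset 'C_G(P) * N.
      by rewrite (subset_trans _ (mulSg _ (setSI _ res_sub))) ?(res_coreN Au sylP).
    have sG : G \subset 'C_G(P) * K by rewrite (res_cent Au sylP).
    by apply: subset_trans sG (subset_trans (mulgS _ sKCN) _); rewrite mulgA mulGid.
  rewrite (subset_trans (quotientS N sGCN)) // quotientMidr sub_cent1.
  have cQ : 'C_G(P) / N \subset 'C(P / N) by rewrite quotient_cents ?subsetIr.
  by rewrite centsC in cQ; rewrite (subsetP cQ) // mem_quotient // -cycle_subG.
have [Bu | nBu] := boolP (u \in B).
  by rewrite (coset_id (p_elt_coreN Bu (p_elt_res nAu Gx ux) ux)) group1.
have := central_p_elt pr_u nAu nBu nur Gx ux.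
move/(mem_quotient N); apply/subsetP; rewrite subsetI quotientS ?center_sub //=.
by rewrite quotient_cents // subsetIr.
Qed.

Lemma sep_fitting_height : fitting_height G <= 3.
Proof.
exact: fitting_height_le3 sep_solvable coreU_normal coreN_normal coreU_sub
  coreU_nil coreN_nil quotient_coreN_nil.
Qed.

(** * Adjacency with r and within A *)

Lemma Sylow_res u T : u \notin A -> u.-Sylow(G) T -> u.-Sylow(K) T.
Proof.
move=> nAu sylT; have [sTG uT _] := and3P sylT.
apply: (pHall_subl _ res_sub sylT); apply/subsetP=> x Tx.
exact: p_elt_res nAu (subsetP sTG x Tx) (mem_p_elt uT Tx).
Qed.

Lemma Sylow_res_normal u T : u \notin A -> u.-Sylow(G) T -> T <| K -> T <| G.
Proof.
move=> nAu sylT nTK; rewrite -(normal_Hall_pcore (Sylow_res nAu sylT) nTK).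
exact: char_normal_trans (pcore_char _ _) res_normal.
Qed.

(* If a is not adjacent to r, elements of K outside the conjugates of C_K(P) are central in K,
   whence K is abelian; then any g centralizing neither Q nor R has br dividing its class size. *)
Lemma classA_edge_r a b : a \in A -> b \in B -> class_prime G r ->
  ~ class_edge G a r -> class_edge G b r.
Proof.
move=> Aa Bb Vr nar; have [pr_r _] := Vr.
have pr_a := prime_sepA Aa; have pr_b := prime_sepB Bb.
have [P sylP] := Sylow_exists a G; set C := 'C_K(P)%G.
(* The K-class of [x] has r-power size prime to r, hence size 1. *)
have ZK x : x \in K -> x \notin class_support C K -> x \in 'Z(K).
  move=> Kx; rewrite (class_support_res Aa sylP Kx) => ax.
  have r'x : r^'.-nat #|x ^: G|.
    rewrite p'natE //; apply/negP=> rx; apply: nar; exists x; first exact: (subsetP res_sub).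
    by rewrite rx andbT; move: ax; rewrite p'natE // negbK.
  have r'xK := pnat_dvd (dvdn_class_normal res_normal (subsetP res_sub x Kx)) r'x.
  have := pnat_1 (classA_r Aa Kx ax) r'xK; rewrite -index_cent1 => /eqP.
  rewrite indexg_eq1 => sKC; rewrite inE Kx -sub_cent1.
  exact: subset_trans sKC (subsetIr _ _).
have sKCZ : K \subset C <*> 'Z(K).
  apply: contraT => nK; have prCZ : C <*> 'Z(K) \proper K.
    by rewrite properE nK andbT join_subG subsetIl center_sub.
  have [x Kx csx] := class_support_proper prCZ.
  have Zx : x \in 'Z(K).
    apply: ZK => //; apply: contra csx; apply/subsetP/class_supportS => //.
    exact: joing_subl.
  by case/negP: csx; apply: mem_class_support; apply: (subsetP (joing_subr _ _)).
have nZC : 'Z(K) \subset 'N(C).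
  by rewrite (subset_trans (subsetIr _ _)) // cents_norm // centS ?subsetIl.
have nCK : K \subset 'N(C) by rewrite (subset_trans sKCZ) // join_subG normG.
have csC : class_support C K \subset C by rewrite class_support_sub_norm.
have [y Zy nCy] : exists2 y, y \in 'Z(K) & y \notin C.
  apply/subsetPn; apply: contra (res_noncentral Aa sylP) => sZC.
  by rewrite (subset_trans sKCZ) // join_subG subsetIr (subset_trans sZC) ?subsetIr.
(* For k in C and y in Z(K) outside C, the product y k is outside the normal subgroup C, hence in
   Z(K). *)
have sCZ : C \subset 'Z(K).
  apply/subsetP=> k Ck; have Ky := subsetP (center_sub K) y Zy.
  rewrite -(groupMl _ Zy) ZK ?groupM ?(subsetP (subsetIl K 'C(P)) k Ck) //.
  by apply: contra nCy => /(subsetP csC); rewrite groupMr.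
have cKK : K \subset 'Z(K) by rewrite (subset_trans sKCZ) // join_subG sCZ subxx.
have nAb : b \notin A by apply: contraL Bb; apply: (sep_disjoint sepG).
have [Q sylQ] := Sylow_exists b G; have [R sylR] := Sylow_exists r G.
have nK T u : u \notin A -> u.-Sylow(G) T -> T <| G.
  move=> nAu sylT; have sTK := pHall_sub (Sylow_res nAu sylT).
  apply: Sylow_res_normal nAu sylT _; apply: sub_der1_normal => //.
  have /derG1P-> : abelian K by apply: subset_trans cKK (subsetIr _ _).
  exact: sub1G.
have nQG := nK _ _ nAb sylQ; have nRG := nK _ _ (sep_neqA sepG) sylR.
have prC T u : class_prime G u -> u.-Sylow(G) T -> 'C_G(T) \proper G.
  move=> Vu sylT; rewrite properE subsetIl subsetI subxx /=.
  exact: class_prime_noncentral Vu sylT.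
have [g Gg /andP[nQg nRg]] := two_proper_subgroups (prC _ _ (class_primeB Bb) sylQ) (prC _ _ Vr sylR).
have dv T u : prime u -> u.-Sylow(G) T -> T <| G -> g \notin 'C_G(T) -> u %| #|g ^: G|.
  move=> pr_u sylT nTG; apply: contraR; rewrite -p'natE // => u'g.
  have [h Gh] := Sylow_cent1 sylT Gg u'g; rewrite (normsP (normal_norm nTG)) //.
  by rewrite sub_cent1 inE Gg.
by exists g; rewrite // (dv Q) // (dv R).
Qed.

Lemma r_elt_coreU x : x \in N -> r.-elt x -> x \in U.
Proof.
move=> Nx rx; have Kx := subsetP coreN_sub x Nx.
have nUx := subsetP (normal_norm coreU_normal_res) x Kx.
apply: coset_idr => //; apply: (fit_coreU_1 (sep_neqB sepG)); last exact: morph_p_elt.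
by case/morphpreP: Nx.
Qed.

(** |z ^: K| is a power of r, hence prime to s, so [z] commutes with a conjugate of [y]; the class
    size of the product is divisible by both p and q. *)
Lemma classA_same_prime p q s s' y z : p \in A -> q \in A -> ~ class_edge G p q ->
  y \in K -> s.-elt y -> ~~ p^'.-nat #|y ^: G| ->
  z \in K -> s'.-elt z -> ~~ q^'.-nat #|z ^: G| -> s != s' -> s != r -> False.
Proof.
move=> Ap Aq npq Ky sy py Kz s'z qz nss' nsr.
have s'nz : s^'.-nat #|z ^: K|.
  by apply: sub_in_pnat (classA_r Aq Kz qz) => v _; rewrite !inE => /eqP->; rewrite eq_sym.
have [g Kg czy] := p_elt_commute Kz s'nz Ky sy.
have syg : s^'^'.-elt (y ^ g) by rewrite p_eltNK p_eltJ.
have s'z' : s^'.-elt z.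
  by apply: sub_in_pnat s'z => v _; rewrite !inE => /eqP->; rewrite eq_sym.
have [dz dy] := dvdn_class_mul G s'z' syg czy.
apply: npq; exists (z * y ^ g); first by rewrite (subsetP res_sub) // groupM ?groupJ.
move: py qz; rewrite !p'natE ?prime_sepA // !negbK => py qz.
rewrite (dvdn_trans qz dz) andbT; apply: dvdn_trans dy.
by rewrite class_conj // (subsetP res_sub).
Qed.

(* If p and q are not adjacent, all primary elements of K whose class size is divisible by p or
   q are s-elements for a single prime s, and lie in S, where S / L is nilpotent and L is an
   s'-group; but S / L is covered by conjugates of the images of C_S(P) and C_S(Q). *)
Lemma classA_edge p q : p \in A -> q \in A -> ~ ~ class_edge G p q.
Proof.
move=> Ap Aq npq.
have [P sylP] := Sylow_exists p G; have [Q sylQ] := Sylow_exists q G.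
have ex1 u T : u \in A -> u.-Sylow(G) T -> exists s y,
    [/\ prime s, y \in K, s.-elt y, y \notin class_support 'C_K(T) K & ~~ u^'.-nat #|y ^: G|].
  move=> Au sylT; have [|s [y []]] := exists_p_elt_classA Au sylT (normal1 K).
    rewrite joingG1 subsetI subxx; exact: res_noncentral sylT.
  by rewrite joingG1; exists s, y.
have [s [y [pr_s Ky sy csy py]]] := ex1 _ _ Ap sylP.
have [s' [z [pr_s' Kz s'z csz qz]]] := ex1 _ _ Aq sylQ.
have same (t1 t2 : nat) y1 y2 : y1 \in K -> t1.-elt y1 -> ~~ p^'.-nat #|y1 ^: G| ->
    y2 \in K -> t2.-elt y2 -> ~~ q^'.-nat #|y2 ^: G| -> t1 = t2.
  move=> K1 e1 p1 K2 e2 q2; apply/eqP; apply: contraT => n12.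
  have [E1 | n1] := eqVneq t1 r; last by case: (classA_same_prime Ap Aq npq K1 e1 p1 K2 e2 q2 n12 n1).
  have nqp : ~ class_edge G q p by case=> x Gx; rewrite andbC => e; apply: npq; exists x.
  have n2 : t2 != r by rewrite -E1 eq_sym.
  by rewrite eq_sym in n12; case: (classA_same_prime Aq Ap nqp K2 e2 q2 K1 e1 p1 n12 n2).
have Ess' := same _ _ _ _ Ky sy py Kz s'z qz; rewrite -{s'}Ess' in pr_s' s'z.
have [S [L [[nSK nLK sLS] nilSL s'L inS]]] : exists S L : {group gT},
    [/\ [/\ S <| K, L <| K & L \subset S], nilpotent (S / L), s^'.-group L &
        forall x u, u \in A -> x \in K -> s.-elt x -> ~~ u^'.-nat #|x ^: G| -> x \in S].
  have inN x u : u \in A -> x \in K -> ~~ u^'.-nat #|x ^: G| -> x \in N.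
    move=> Au Kx ux; rewrite mem_coreN // r_nat_B' //; exact: classA_r Au Kx ux.
  (* For s = r the s-elements of N lie in the nilpotent group U. Otherwise s is in B, because [y] is
     not central, and U is an s'-group. *)
  have [Esr | nsr] := eqVneq s r.
    exists U, 1%G; split; rewrite ?pgroup1 ?quotient_nil ?coreU_nil //.
      by rewrite coreU_normal_res normal1 sub1G.
    move=> x u Au Kx sx ux; apply: r_elt_coreU; last by rewrite -Esr.
    exact: inN Au Kx ux.
  exists N, U; split; rewrite ?coreN_nil //.
  - by rewrite coreN_normal_res coreU_normal_res coreU_sub.
  - apply: sub_in_pnat (pcore_pgroup B^' K) => v _; rewrite !inE.
    suff Bs : s \in B by apply: contraNneq => ->.
    apply: contraR py => nBs; have Gy := subsetP res_sub y Ky.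
    have y1 : y \in 'Z(G) -> p^'.-nat #|y ^: G|.
      case/setIP=> _ cy; rewrite -index_cent1 (setIidPl _) ?indexgg //.
      by rewrite sub_cent1.
    have [As | nAs] := boolP (s \in A); first by rewrite y1 // (res_p'elt As Ky sy) group1.
    by rewrite y1 // (central_p_elt pr_s nAs nBs nsr Gy sy).
  by move=> x u Au Kx _ ux; apply: inN Au Kx ux.
have sSK := normal_sub nSK; have nLS := subset_trans sSK (normal_norm nLK).
(* Otherwise some primary element outside the conjugates of C_K(T) S has class size divisible by u;
   it is an s-element, hence in S. *)
have KCS u T : u \in A -> u.-Sylow(G) T ->
    (forall (s1 : nat) y1, y1 \in K -> s1.-elt y1 -> ~~ u^'.-nat #|y1 ^: G| -> s1 = s) ->
    'C_K(T) * S = K.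
  move=> Au sylT onlys; apply/eqP; rewrite eqEsubset mul_subG ?subsetIl //=.
  rewrite -norm_joinEl ?(subset_trans (subsetIl _ _)) ?normal_norm //.
  apply: contraT => nKCS.
  have [s1 [y1 [_ Ky1 s1y1 csy1 uy1]]] := exists_p_elt_classA Au sylT nSK nKCS.
  case/negP: csy1; apply/mem_class_support/(subsetP (joing_subr _ _)).
  by apply: (inS _ u) => //; rewrite -(onlys _ _ Ky1 s1y1 uy1).
have loc u T x : u \in A -> u.-Sylow(G) T -> 'C_K(T) * S = K -> x \in S ->
    u^'.-nat #|x ^: G| -> x \in class_support ('C_K(T) :&: S) S.
  move=> Au sylT defK Sx; rewrite -(class_support_res Au sylT (subsetP sSK x Sx)).
  rewrite -[X in class_support _ X]defK (@class_support_mulr _ _ 'C_K(T)%G S) ?normG //.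
  case/class_supportP=> n Sn Cx; apply/class_supportP; exists n => //.
  by rewrite inE Cx groupJ ?groupV.
have fin u T y1 : u.-Sylow(G) T -> 'C_K(T) * S = K -> ('C_K(T) :&: S) / L = S / L ->
    y1 \in K -> s.-elt y1 -> y1 \in class_support 'C_K(T) K.
  move=> sylT defK defS Ky1 sy1.
  apply: (@p_elt_class_support_join _ s K 'C_K(T)%G L) => //; first exact: subsetIl.
  apply: mem_class_support; rewrite norm_joinEl; last first.
    by rewrite (subset_trans (subsetIl _ _)) ?normal_norm.
  have sSCL : S \subset 'C_K(T) * L.
    have : S / L \subset 'C_K(T) / L by rewrite -defS quotientS ?subsetIl.
    by rewrite quotientSK // (normC (subset_trans (subsetIl K _) (normal_norm nLK))).
  have : K \subset 'C_K(T) * S by rewrite defK.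
  move/subset_trans/(_ (mulgS _ sSCL)); rewrite mulgA mulGid => /subsetP; exact.
have KS := KCS _ _ Ap sylP (fun s1 y1 K1 e1 h1 => same _ _ _ _ K1 e1 h1 Kz s'z qz).
have KS' := KCS _ _ Aq sylQ (fun s1 z1 K1 e1 h1 => esym (same _ _ _ _ Ky sy py K1 e1 h1)).
have sCS T : 'C_K(T) :&: S \subset 'N(L) by apply: subset_trans nLS; apply: subsetIr.
have [||| defS | defS] :=
    @nilpotent_cover _ (S / L)%G (('C_K(P) :&: S) / L)%G (('C_K(Q) :&: S) / L)%G nilSL.
- by rewrite quotientS ?subsetIr.
- by rewrite quotientS ?subsetIr.
- apply/subsetP=> _ /morphimP[x _ Sx ->]; rewrite inE; apply/orP.
  have Gx := subsetP res_sub x (subsetP sSK x Sx).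
  have [p'x | px] := boolP (p^'.-nat #|x ^: G|).
    left; apply: (class_support_quotient (sCS P) nLS); exact: loc Ap sylP KS Sx p'x.
  right; apply: (class_support_quotient (sCS Q) nLS); apply: (loc _ _ _ Aq sylQ KS' Sx).
  rewrite p'natE ?prime_sepA //; apply/negP=> qx; apply: npq; exists x => //.
  by rewrite qx andbT; move: px; rewrite p'natE ?prime_sepA // negbK.
- by case/negP: csy; apply: fin sylP KS defS Ky sy.
by case/negP: csz; apply: fin sylQ KS' defS Kz s'z.
Qed.

(** * Adjacency within B *)

Lemma notinA_B b : b \in B -> b \notin A.
Proof. by move=> Bb; apply: contraL Bb; apply: (sep_disjoint sepG). Qed.

(** T lies in N, and T U / U is the Sylow b-subgroup of the nilpotent group N / U, hence
    characteristic in it. *)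
Lemma Sylow_joinU b T : b \in B -> b.-Sylow(G) T ->
  T <*> U <| K /\ b.-Sylow(T <*> U) T.
Proof.
move=> Bb sylT; have sylTK := Sylow_res (notinA_B Bb) sylT.
have [sTK bT _] := and3P sylTK.
have sTN : T \subset N.
  by apply/subsetP=> x Tx; apply: p_elt_coreN Bb (subsetP sTK x Tx) (mem_p_elt bT Tx).
have nUT : T \subset 'N(U) := subset_trans sTK (normal_norm coreU_normal_res).
have nTU : T <*> U <| K; last first.
  split=> //; apply: pHall_subl (joing_subl _ _) (normal_sub nTU) sylTK.
have sylTN : b.-Sylow(N / U) (T / U).
  apply: quotient_pHall nUT (pHall_subl sTN coreN_sub sylTK).
have defT : T / U = 'O_b(N / U) := nilpotent_Hall_pcore coreN_nil sylTN.
have nTUU : U <| T <*> U by rewrite /normal joing_subr join_subG nUT normG.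
rewrite -(quotientGK nTUU) quotientYidr // defT.
suff : (coset U @*^-1 'O_b(N / U))%G <| coset U @*^-1 (K / U).
  by rewrite quotientGK ?coreU_normal_res.
rewrite cosetpre_normal; apply: char_normal_trans (pcore_char _ _) _.
exact: quotient_normal coreN_normal_res.
Qed.

Lemma res_normU b T : b \in B -> b.-Sylow(G) T -> 'N_K(T) * U = K.
Proof.
move=> Bb sylT; have [nTUK sylTU] := Sylow_joinU Bb sylT.
have sTK := pHall_sub (Sylow_res (notinA_B Bb) sylT).
have nUN : 'N_K(T) \subset 'N(U).
  by rewrite (subset_trans (subsetIl _ _)) ?normal_norm ?coreU_normal_res.
have := Frattini_arg nTUK sylTU; rewrite /= joingC norm_joinEr; last first.
  by rewrite (subset_trans sTK) ?normal_norm ?coreU_normal_res.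
rewrite -mulgA (mulSGid (_ : T \subset 'N_K(T))) ?subsetI ?sTK ?normG //.
by rewrite (normC nUN).
Qed.

(** K = N_K(T) U and N_K(T) normalizes C_K(T), so conjugation by the nilpotent group U is enough. *)
Lemma class_support_resU b T x : b \in B -> b.-Sylow(G) T -> x \in K ->
  b^'.-nat #|x ^: G| -> x \in class_support 'C_K(T) U.
Proof.
move=> Bb sylT Kx b'x; have sylTK := Sylow_res (notinA_B Bb) sylT.
have b'xK := pnat_dvd (dvdn_class_normal res_normal (subsetP res_sub x Kx)) b'x.
have : x \in class_support 'C_K(T) K by rewrite (class_support_cent sylTK).
rewrite -[X in class_support _ X](res_normU Bb sylT).
rewrite (@class_support_mulr _ _ 'N_K(T)%G U) //.
by rewrite normsI ?norms_cent ?subsetIr // (subset_trans (subsetIl _ _)) ?normG.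
Qed.

(* U is covered by conjugates of C_U(Q) and C_U(T), so U centralizes T and T is normal in G.  An
   element z of U whose class size is divisible by q commutes with T, so that no class size of
   an element of T is divisible by t or by a prime of A; this makes T central in G. *)
Lemma classB_edge_central q t : q \in B -> t \in B -> q != t ->
  central_Sylows G q -> ~ ~ class_edge G q t.
Proof.
move=> Bq Bt nqt cSq nedge.
have [nAq nAt] := (notinA_B Bq, notinA_B Bt).
have [pr_q pr_t] := (prime_sepB Bq, prime_sepB Bt).
have [Q sylQ] := Sylow_exists q G; have [T sylT] := Sylow_exists t G.
have sylQK := Sylow_res nAq sylQ; have sylTK := Sylow_res nAt sylT.
have sUK : U \subset K := normal_sub coreU_normal_res.
have sUG := subset_trans sUK res_sub.
have nQT x : x \in G -> q^'.-nat #|x ^: G| \/ t^'.-nat #|x ^: G|.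
  move=> Gx; rewrite !p'natE //; apply/orP; rewrite -negb_and.
  by apply/negP=> qt; apply: nedge; exists x.
have defK : 'C_K(Q) * U = K.
  apply/eqP; rewrite eqEsubset mul_subG ?subsetIl //=.
  have : K \subset 'N_K(Q) * U by rewrite (res_normU Bq sylQ).
  move/subset_trans; apply; rewrite mulSg // subsetI subsetIl.
  by rewrite (subset_trans _ (cSq Q sylQ)) // setSI ?res_sub.
(* If U centralized Q, so would K = C_K(Q) U; then Q would be normal in G, and N_G(Q) = C_G(Q) would
   make it central. *)
have nUCQ : ~~ (U \subset 'C(Q)).
  apply/negP=> cUQ; case/negP: (class_prime_noncentral (class_primeB Bq) sylQ).
  have cKQ : K \subset 'C(Q) by rewrite -defK mul_subG ?subsetIr.
  have nQK : Q <| K by rewrite /normal (pHall_sub sylQK) cents_norm.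
  have /andP[_ nQG] := Sylow_res_normal nAq sylQ nQK.
  by rewrite (subset_trans _ (cSq Q sylQ)) // subsetI subxx.
have covY Y : U \subset Y -> Y \subset K -> forall x, x \in Y ->
    q^'.-nat #|x ^: G| -> x \in class_support 'C_Y(Q) Y.
  move=> sUY sYK x Yx q'x.
  case/class_supportP: (class_support_resU Bq sylQ (subsetP sYK x Yx) q'x).
  move=> g Ug /setIP[_ cQ]; have Yg := subsetP sUY g Ug.
  by apply/class_supportP; exists g; rewrite // inE groupJ ?groupV.
have cUT : U \subset 'C(T).
  have [|||/= E|/= E] := @nilpotent_cover _ U 'C_U(Q)%G 'C_U(T)%G coreU_nil.
  - exact: subsetIl.
  - exact: subsetIl.
  - apply/subsetP=> x Ux; rewrite inE; apply/orP.
    have [q'x | t'x] := nQT x (subsetP sUG x Ux); [left; exact: covY | right].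
    case/class_supportP: (class_support_resU Bt sylT (subsetP sUK x Ux) t'x).
    move=> g Ug /setIP[_ cT]; apply/class_supportP; exists g => //.
    by rewrite inE groupJ ?groupV.
  - by case/negP: nUCQ; apply/setIidPl.
  exact/setIidPl.
have nTK : T <| K.
  have [nTU sylTU] := Sylow_joinU Bt sylT.
  have nT_TU : T <| T <*> U by rewrite /normal joing_subl join_subG normG cents_norm.
  by rewrite -(normal_Hall_pcore sylTU nT_TU); apply: char_normal_trans (pcore_char _ _) nTU.
have nTG := Sylow_res_normal nAt sylT nTK.
have [sTG tT _] := and3P sylT.
have cT_t x : x \in G -> t^'.-nat #|x ^: G| -> x \in 'C(T).
  move=> Gx t'x; have [g Gg] := Sylow_cent1 sylT Gx t'x.
  by rewrite (normsP (normal_norm nTG)) // sub_cent1.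
have [z Uz qz] : exists2 z, z \in U & ~~ q^'.-nat #|z ^: G|.
  have prU : 'C_U(Q) \proper U by rewrite properE subsetIl subsetI subxx.
  have [z Uz csz] := class_support_proper prU.
  by exists z => //; apply: contra csz; apply: covY.
(* The class size of x z is divisible by q, which excludes A and, by nonadjacency, t; the class size
   of x divides it. *)
have Tprop x : x \in T -> A^'.-nat #|x ^: G| /\ t^'.-nat #|x ^: G|.
  move=> Tx; have Gx := subsetP sTG x Tx; have Gz := subsetP sUG z Uz.
  have tx : t.-elt x := mem_p_elt tT Tx.
  have t'z : t^'.-elt z.
    by apply: pi'_p'nat (mem_p_elt (pcore_pgroup _ _) Uz) _.
  have cxz : commute x z by apply/commute_sym/(centP (subsetP cUT z Uz)).
  have [dx dz] := dvdn_class_mul G tx t'z cxz.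
  have Gxz : x * z \in G by rewrite groupM.
  have qxz : ~~ q^'.-nat #|(x * z) ^: G| by apply: contra qz; apply: pnat_dvd.
  split; apply: pnat_dvd dx _; last by have [q'xz | //] := nQT _ Gxz; rewrite q'xz in qxz.
  have [// | B'xz] := sep_class sepG Gxz.
  case/negP: qxz; by apply: pi'_p'nat B'xz _.
have cTT : T \subset 'C(T).
  by apply/subsetP=> x Tx; apply: cT_t (subsetP sTG x Tx) (Tprop x Tx).2.
have cKT : K \subset 'C(T).
  apply: p_elts_sub => u x pr_u Kx ux; have Gx := subsetP res_sub x Kx.
  have sx : <[x]> \subset G by rewrite cycle_subG.
  have [X sylX sxX] := Sylow_superset sx ux.
  have Xx : x \in X by rewrite -cycle_subG.
  have [Au | nAu] := boolP (u \in A); first by rewrite (res_p'elt Au Kx ux) group1.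
  have [sXK uX _] := and3P (Sylow_res nAu sylX).
  have nUX : X \subset 'N(U) := subset_trans sXK (normal_norm coreU_normal_res).
  have [Bu | nBu] := boolP (u \in B).
    have [Eut | nut] := eqVneq u t.
      by apply: (subsetP cTT); rewrite (mem_normal_Hall sylTK nTK) // -Eut.
    have [nXU _] := Sylow_joinU Bu sylX.
    (* T and X U are normal in K of coprime orders, hence commute. *)
    have tiTX : T :&: (X <*> U) = 1.
      apply: coprime_TIg; rewrite /= norm_joinEl //.
      apply: (pnat_coprime tT); rewrite -/(pgroup _ _) pgroupM.
      apply/andP; split; first by apply: sub_in_pnat uX => v _; rewrite !inE => /eqP->.
      by apply: pi'_p'nat (pcore_pgroup _ K) _.
    have : [~: T, X <*> U] \subset [1].
      rewrite -tiTX subsetI commg_subl commg_subr.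
      by rewrite (subset_trans (normal_sub nXU) (normal_norm nTK))
         (subset_trans (normal_sub nTK) (normal_norm nXU)).
    rewrite subG1 => /eqP/commG1P cTX; rewrite centsC in cTX.
    by rewrite (subsetP cTX) // (subsetP (joing_subl _ _)).
  have [Eur | nur] := eqVneq u r; last first.
    have /setIP[_ cx] := central_p_elt pr_u nAu nBu nur Gx ux.
    by apply: subsetP cx; apply: centS.
  (* For u = r the group X U is a nilpotent B'-group, again covered by conjugates of two
     centralizers. *)
  set Y := (X <*> U)%G; have sUY : U \subset Y := joing_subr _ _.
  have sYK : Y \subset K by rewrite join_subG sXK.
  have B'Y : B^'.-group Y.
    rewrite /= norm_joinEl // pgroupM pcore_pgroup andbT.
    by apply: sub_in_pnat uX => v _; rewrite !inE Eur => /eqP->; apply: sep_neqB sepG.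
  have nilY : nilpotent Y.
    apply: nilpotent_joinU sUY sYK _ => b f Bb Yf bf.
    apply/eqP; rewrite -order_eq1 -(part_pnat_id bf) part_p'nat //.
    by apply: pi'_p'nat (mem_p_elt B'Y Yf) _.
  have [|||/= E|/= E] := @nilpotent_cover _ Y 'C_Y(Q)%G 'C_Y(T)%G nilY.
  - exact: subsetIl.
  - exact: subsetIl.
  - apply/subsetP=> f Yf; rewrite inE; apply/orP.
    have Gf := subsetP (subset_trans sYK res_sub) f Yf.
    have [q'f | t'f] := nQT f Gf; [left; exact: covY | right].
    by apply: mem_class_support; rewrite inE Yf cT_t.
  - by case/negP: nUCQ; apply: subset_trans sUY _; apply/setIidPl.
  by move/setIidPl/subsetP: E; apply; apply: (subsetP (joing_subl _ _)).
(* No prime of A divides the class size of [x], so [x] lies in a K-conjugate of C_K(P), and K fixes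
   [x]. *)
have cPT a P : a \in A -> a.-Sylow(G) P -> P \subset 'C(T).
  move=> Aa sylP; rewrite centsC; apply/subsetP=> x Tx.
  have Kx : x \in K by rewrite (subsetP (pHall_sub sylTK)).
  have : x \in class_support 'C_K(P) K.
    rewrite (class_support_res Aa sylP Kx).
    apply: sub_in_pnat (Tprop x Tx).1 => v _; rewrite !inE.
    by apply: contraNneq => ->.
  case/class_supportP=> g Kg /setIP[_]; suff -> : x ^ g^-1 = x by [].
  apply/conjg_fixP/commgP/commuteV; exact/commute_sym/(centP (subsetP cKT g Kg)).
case/negP: (class_prime_noncentral (class_primeB Bt) sylT).
apply: p_elts_sub => u x pr_u Gx ux.
have [Au | nAu] := boolP (u \in A); last exact: subsetP cKT x (p_elt_res nAu Gx ux).
have sx : <[x]> \subset G by rewrite cycle_subG.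
have [X sylX sxX] := Sylow_superset sx ux.
by rewrite (subsetP (cPT u X Au sylX)) // -cycle_subG.
Qed.

End Residual.

(** * Graphs made of two cliques and a vertex *)

Section Graphs.

Variable T : finType.
Implicit Types (Gr : sgraph T) (A B C : {set T}) (x y r s : T).

Lemma connect_gadj_sym Gr : connect_sym (gadj Gr).
Proof. exact/sym_connect_sym/gadj_sym. Qed.

Lemma componentsP Gr C :
  reflect (exists2 x, x \in gverts Gr & C = [set y in gverts Gr | connect (gadj Gr) x y])
          (C \in components Gr).
Proof. exact: imsetP. Qed.

Lemma components_gt0 Gr x : x \in gverts Gr -> 0 < #|components Gr|.
Proof.
move=> Vx; apply/card_gt0P; exists [set y in gverts Gr | connect (gadj Gr) x y].
by apply/componentsP; exists x.
Qed.

Lemma components_le1 Gr :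
  #|components Gr| <= 1 <-> {in gverts Gr &, forall x y, connect (gadj Gr) x y}.
Proof.
split=> [/card_le1_eqP eqC x y Vx Vy | conG].
  have : y \in [set z in gverts Gr | connect (gadj Gr) y z] by rewrite inE Vy connect0.
  suff -> : [set z in gverts Gr | connect (gadj Gr) y z] =
            [set z in gverts Gr | connect (gadj Gr) x z] by rewrite inE => /andP[].
  by apply: eqC; apply/componentsP; [exists x | exists y].
apply/card_le1_eqP => _ _ /componentsP[x Vx ->] /componentsP[y Vy ->].
apply/setP=> z; rewrite !inE; apply: andb_id2l => Vz.
by rewrite !conG.
Qed.

Lemma gverts_del Gr r : gverts (del_vertex Gr r) = gverts Gr :\ r.
Proof. by apply/setIidPr/subD1set. Qed.

Lemma gadj_del Gr r x y :
  gadj (del_vertex Gr r) x y = [&& x != r, y != r & gadj Gr x y].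
Proof.
rewrite -[LHS]/[&& x \in _ :\ r, y \in _ :\ r & gadj Gr x y] !inE.
apply/idP/idP; first by case/and3P=> /andP[-> _] /andP[-> _] ->.
case/and3P=> -> -> xy; rewrite xy (gadj_verts xy) /=.
by rewrite gadj_sym in xy; rewrite (gadj_verts xy).
Qed.

(** Gr has at least one component, that of s, so Gr - s has at least two. *)
Lemma cut_vertexP Gr s : cut_vertex Gr s ->
  exists x y, [/\ x \in gverts Gr :\ s, y \in gverts Gr :\ s &
    ~~ connect (gadj (del_vertex Gr s)) x y].
Proof.
case/andP=> Vs lt_s.
have /existsP[x /existsP[y]] : [exists x, exists y, [&& x \in gverts Gr :\ s,
    y \in gverts Gr :\ s & ~~ connect (gadj (del_vertex Gr s)) x y]].
  apply: contraLR lt_s => nex; rewrite -leqNgt (leq_trans _ (components_gt0 Vs)) //.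
  apply/components_le1 => x y; rewrite gverts_del => Vx Vy.
  apply: contraR nex => nxy; apply/existsP; exists x; apply/existsP; exists y.
  by rewrite Vx Vy.
by case/and3P=> Vx Vy nxy; exists x, y.
Qed.

Lemma cut_vertex_hub Gr s r :
  (forall x, x \in gverts Gr :\ s -> connect (gadj (del_vertex Gr s)) r x) ->
  ~~ cut_vertex Gr s.
Proof.
move=> hub; apply/negP=> /cut_vertexP[x [y [/hub rx /hub ry]]]; apply/negP.
by rewrite negbK (connect_trans _ ry) // connect_gadj_sym.
Qed.

Lemma distance_le Gr x p : path (gadj Gr) x p -> distance Gr x (last x p) <= size p.
Proof.
move=> pth; have cxy : connect (gadj Gr) x (last x p) by apply/connectP; exists p.
by apply: (distanceP cxy).2; apply/existsP; exists (in_tuple p); rewrite /= pth /=.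
Qed.

Section TwoCliques.

Variables (Gr : sgraph T) (r : T) (A B : {set T}).
Hypotheses (cut_r : cut_vertex Gr r) (defV : gverts Gr :\ r = A :|: B).
Hypotheses (ntA : A != set0) (ntB : B != set0).
Hypothesis nAB : {in A & B, forall x y, ~~ gadj Gr x y}.
Hypothesis cliqueA : {in A &, forall x y, x != y -> gadj Gr x y}.
Hypothesis cliqueB : {in B &, forall x y, x != y -> gadj Gr x y}.
Hypothesis near_r : {in A & B, forall x y, gadj Gr x r || gadj Gr y r}.
Hypothesis disjAB : [disjoint A & B].

Let notAB x : x \in B -> x \notin A.
Proof. by move=> Bx; apply: contraL disjAB => Ax; apply/pred0Pn; exists x; rewrite /= Ax. Qed.

Let r_notin : r \notin A :|: B.
Proof. by rewrite -defV !inE eqxx. Qed.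

Let neq_r x : x \in A :|: B -> x != r.
Proof. by apply: contraTneq => ->. Qed.

Let closedA : closed (gadj (del_vertex Gr r)) A.
Proof.
apply: intro_closed; first exact: connect_gadj_sym.
move=> x y; rewrite gadj_del => /and3P[xr yr xy] Ax.
have : y \in A :|: B.
  rewrite -defV !inE yr; rewrite gadj_sym in xy; exact: gadj_verts xy.
by rewrite inE => /orP[// | By]; case/negP: (nAB Ax By).
Qed.

Let clique_connect C : {in C &, forall x y, x != y -> gadj Gr x y} ->
  C \subset A :|: B -> {in C &, forall x y, connect (gadj (del_vertex Gr r)) x y}.
Proof.
move=> clC /subsetP sC x y Cx Cy; have [-> | nxy] := eqVneq x y; first exact: connect0.
by apply: connect1; rewrite gadj_del !neq_r ?sC ?clC.
Qed.

Lemma two_cliques_components : components (del_vertex Gr r) = [set A; B].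
Proof.
have blockA x : x \in A ->
    [set y in gverts (del_vertex Gr r) | connect (gadj (del_vertex Gr r)) x y] = A.
  move=> Ax; apply/setP=> y; rewrite gverts_del defV !inE; apply/andP/idP => [[_ cxy] | Ay].
    by rewrite -(closed_connect closedA cxy).
  by rewrite Ay; split=> //; apply: (clique_connect cliqueA); rewrite ?subsetUl.
have blockB x : x \in B ->
    [set y in gverts (del_vertex Gr r) | connect (gadj (del_vertex Gr r)) x y] = B.
  move=> Bx; apply/setP=> y; rewrite gverts_del defV !inE; apply/andP/idP => [[ABy cxy] | By].
    by case/orP: ABy => // Ay; rewrite -(closed_connect closedA cxy) (negPf (notAB Bx)) in Ay.
  by rewrite By orbT; split=> //; apply: (clique_connect cliqueB); rewrite ?subsetUr.
apply/setP=> C; rewrite !inE; apply/componentsP/orP => [[x Vx ->] | ].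
  have : x \in A :|: B by rewrite -defV -gverts_del.
  rewrite inE => /orP[/blockA | /blockB] ->; rewrite eqxx; by [left | right].
case=> /eqP->.
  have [x Ax] := set0Pn _ ntA; exists x; last by rewrite blockA.
  by rewrite gverts_del defV inE Ax.
have [x Bx] := set0Pn _ ntB; exists x; last by rewrite blockB.
by rewrite gverts_del defV inE Bx orbT.
Qed.

Lemma card_two_cliques : #|components (del_vertex Gr r)| = 2.
Proof.
rewrite two_cliques_components cards2 (_ : A != B) //.
have [x Bx] := set0Pn _ ntB; apply: contraNneq (notAB Bx) => ->; exact: Bx.
Qed.

Lemma two_cliques_complete C : C \in components (del_vertex Gr r) ->
  complete_graph (induced (del_vertex Gr r) C).
Proof.
rewrite two_cliques_components !inE => defC.
have clC : {in C &, forall x y, x != y -> gadj Gr x y} by case/orP: defC => /eqP->.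
have sC : C \subset A :|: B by case/orP: defC => /eqP->; rewrite ?subsetUl ?subsetUr.
apply/forall_inP=> x /setIP[_ Cx]; apply/forall_inP=> y /setIP[_ Cy].
apply/implyP=> nxy; apply/and3P; split=> //.
by rewrite gadj_del !neq_r ?(subsetP sC) ?clC.
Qed.

Lemma two_cliques_complete_vertex s :
  complete_vertex Gr s -> s = r.
Proof.
case/andP=> Vs /forall_inP adj_s; apply/eqP; apply: contraT => nsr.
have sV C : C \subset A :|: B -> {subset C <= gverts Gr}.
  by move=> sC x /(subsetP sC); rewrite -defV => /setD1P[].
have : s \in A :|: B by rewrite -defV !inE nsr.
rewrite inE => /orP[As | Bs].
  have [b Bb] := set0Pn _ ntB; have := adj_s b (sV _ (subsetUr _ _) b Bb).
  rewrite (negPf (nAB As Bb)) implybF negbK => /eqP Ebs.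
  by move: (notAB Bb); rewrite Ebs As.
have [a Aa] := set0Pn _ ntA; have := adj_s a (sV _ (subsetUl _ _) a Aa).
rewrite gadj_sym (negPf (nAB Aa Bs)) implybF negbK => /eqP Eas.
by move: (notAB Bs); rewrite -Eas Aa.
Qed.

Lemma complete_vertex_cut s : complete_vertex Gr r -> cut_vertex Gr s -> s = r.
Proof.
case/andP=> Vr /forall_inP adj_r cut_s; apply/eqP; apply: contraTT cut_s => nsr.
apply: (@cut_vertex_hub _ _ r) => x /setD1P[nxs Vx].
have [-> | nxr] := eqVneq x r; first exact: connect0.
apply: connect1; rewrite gadj_del eq_sym nsr nxs.
by have := adj_r x Vx; rewrite nxr.
Qed.

(** Gr has fewer components than Gr - r, which has two. *)
Lemma two_cliques_connected : {in gverts Gr &, forall x y, connect (gadj Gr) x y}.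
Proof.
apply/components_le1; rewrite -ltnS; case/andP: cut_r => _.
by rewrite card_two_cliques.
Qed.

(** Otherwise A is closed under adjacency in the connected graph Gr, which also contains r. *)
Lemma two_cliques_nearA : exists2 a, a \in A & gadj Gr a r.
Proof.
apply/exists_inP; rewrite -[X in is_true X]negbK negb_exists_in; apply/negP=> /forall_inP nar.
have clA : closed (gadj Gr) A.
  apply: intro_closed; first exact: connect_gadj_sym.
  move=> x y xy Ax; have [Eyr | nyr] := eqVneq y r.
    by move: (nar x Ax); rewrite -Eyr xy.
  have : y \in A :|: B.
    rewrite -defV !inE nyr; rewrite gadj_sym in xy; exact: gadj_verts xy.
  by rewrite inE => /orP[// | By]; case/negP: (nAB Ax By).
have [a Aa] := set0Pn _ ntA; case/andP: cut_r => Vr _.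
have Va : a \in gverts Gr.
  by have := subsetUl A B; move/subsetP/(_ a Aa); rewrite -defV => /setD1P[].
have := closed_connect clA (two_cliques_connected Va Vr); rewrite Aa => Ar.
by move: r_notin; rewrite inE -Ar.
Qed.

(** All of B is adjacent to r because v is not, and so is some a in A. The path v, a, r, b realizes
    distance 3, and deleting a vertex other than r and a leaves all others connected to r. *)
Lemma two_cliques_far v : v \in A -> ~~ gadj Gr v r ->
  diameter Gr = Some 3 /\ #|[set s | cut_vertex Gr s]| <= 2.
Proof.
move=> Av nvr; have [a Aa ar] := two_cliques_nearA.
have Br b : b \in B -> gadj Gr b r.
  by move=> Bb; have := near_r Av Bb; rewrite (negPf nvr).
have ra : gadj Gr r a by rewrite gadj_sym.
have rB b : b \in B -> gadj Gr r b by move=> Bb; rewrite gadj_sym Br.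
have Vcase x : x \in gverts Gr -> [\/ x = r, x \in A | x \in B].
  move=> Vx; have [-> | nxr] := eqVneq x r; first by constructor 1.
  have : x \in A :|: B by rewrite -defV !inE nxr.
  by rewrite inE => /orP[]; [constructor 2 | constructor 3].
have VA x : x \in A -> x \in gverts Gr.
  by move=> Ax; have : x \in A :|: B by [rewrite inE Ax]; rewrite -defV => /setD1P[].
have VB x : x \in B -> x \in gverts Gr.
  by move=> Bx; have : x \in A :|: B by [rewrite inE Bx orbT]; rewrite -defV => /setD1P[].
have dist x y p : path (gadj Gr) x p -> last x p = y -> size p <= 3 -> distance Gr x y <= 3.
  by move=> pth <-; apply: leq_trans (distance_le pth).
have dle x y : x \in gverts Gr -> y \in gverts Gr -> distance Gr x y <= 3.
  move=> /Vcase Vx /Vcase Vy.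
  have [-> | nxy] := eqVneq x y; first exact: (dist _ _ [::]).
  case: Vx nxy => [-> | Ax | Bx]; case: Vy => [-> | Ay | By] nxy.
  - by rewrite eqxx in nxy.
  - have [-> | nay] := eqVneq y a; first by apply: (dist _ _ [:: a]); rewrite /= ?ra.
    by apply: (dist _ _ [:: a; y]); rewrite /= ?ra ?cliqueA // eq_sym.
  - by apply: (dist _ _ [:: y]); rewrite /= ?rB.
  - have [-> | nay] := eqVneq x a; first by apply: (dist _ _ [:: r]); rewrite /= ?ar.
    by apply: (dist _ _ [:: a; r]); rewrite /= ?ar ?cliqueA.
  - by apply: (dist _ _ [:: y]); rewrite /= ?cliqueA.
  - have [-> | nay] := eqVneq x a; first by apply: (dist _ _ [:: r; y]); rewrite /= ?ar ?rB.
    by apply: (dist _ _ [:: a; r; y]) => //=; rewrite ar rB // cliqueA.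
  - by apply: (dist _ _ [:: r]); rewrite /= ?Br.
  - have [-> | nay] := eqVneq y a; first by apply: (dist _ _ [:: r; a]); rewrite /= ?ra ?Br.
    by apply: (dist _ _ [:: r; a; y]) => //=; rewrite ra Br // cliqueA // eq_sym.
  - by apply: (dist _ _ [:: y]); rewrite /= ?cliqueB.
have [b Bb] := set0Pn _ ntB.
have dge : 3 <= distance Gr v b.
  have [+ _] := distanceP (two_cliques_connected (VA _ Av) (VB _ Bb)).
  rewrite leqNgt; move: (distance Gr v b) => [|[|[|//]]] /existsP[p] /andP[].
  - rewrite [p]tuple0 /= => _ /eqP Evb.
    by move: (notAB Bb); rewrite -Evb Av.
  - case/tupleP: p => x p; rewrite [p]tuple0 /= andbT => vx /eqP Exb.
    by case/negP: (nAB Av Bb); rewrite -Exb.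
  case/tupleP: p => x p; case/tupleP: p => y p; rewrite [p]tuple0 /= andbT.
  case/andP=> vx xy /eqP Eyb; rewrite {y}Eyb in xy.
  case: (Vcase _ (gadj_verts xy)) => [Exr | Ax | Bx].
  - by case/negP: nvr; rewrite -Exr.
  - by case/negP: (nAB Ax Bb).
  by case/negP: (nAB Av Bx).
split.
  rewrite /diameter (_ : is_connected Gr); last first.
    by apply/forall_inP=> x Vx; apply/forall_inP=> y Vy; apply: two_cliques_connected.
  congr Some; apply/eqP; rewrite eqn_leq; apply/andP; split.
    by apply/bigmax_leqP=> x Vx; apply/bigmax_leqP=> y Vy; apply: dle.
  apply: leq_trans dge (leq_trans _ (leq_bigmax_cond _ (VA _ Av))).
  exact: (leq_bigmax_cond _ (VB _ Bb)).
apply: leq_trans (_ : #|[set r; a]| <= 2); last by rewrite cards2; case: (_ != _).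
apply/subset_leq_card/subsetP=> s; rewrite !inE; apply: contraLR.
rewrite negb_or => /andP[nsr nsa]; apply: (@cut_vertex_hub _ _ r) => x /setD1P[nxs Vx].
have ra' : connect (gadj (del_vertex Gr s)) r a.
  by apply: connect1; rewrite gadj_del ra !(eq_sym _ s) nsr nsa.
case: (Vcase _ Vx) => [-> | Ax | Bx]; first exact: connect0.
  have [-> // | nxa] := eqVneq x a.
  apply: connect_trans ra' (connect1 _); rewrite gadj_del (eq_sym a) nsa nxs.
  by rewrite cliqueA // eq_sym.
by apply: connect1; rewrite gadj_del (eq_sym r) nsr nxs rB.
Qed.

End TwoCliques.

End Graphs.

(** * From separations to adjacency in Delta(G) *)

Section SeparatedGroups.

Variables (gT : finGroupType) (G : {group gT}).
Implicit Types (A B : nat_pred) (a b p q r : nat) (v w : 'I_#|G|.+1).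

(** Edges stand under a double negation because the proofs refute the nonexistence of an element;
    the boolean [gadj] removes it later. *)
Definition separated A B r :=
  [/\ solvable G /\ fitting_height G <= 3,
      {in A &, forall p q, p != q -> ~ ~ class_edge G p q},
      {in B &, forall p q, p != q -> ~ ~ class_edge G p q} &
      {in A & B, forall a b, ~ class_edge G a r -> class_edge G b r}].

Lemma separation_central_Sylows A B r :
  separation G A B r -> class_prime G r -> (exists p, p \in A) ->
  (forall p, p \in A -> central_Sylows G p) -> separated A B r.
Proof.
move=> sepG Vr ntA cSA; split.
- by split; [apply: sep_solvable sepG _ _ | apply: sep_fitting_height sepG _ _].
- by move=> p q Ap Aq _; apply: classA_edge sepG _ _ _ _ Ap Aq.
- move=> p q Bp Bq npq nedge.
  have [pr_p pr_q] := (prime_sepB sepG Bp, prime_sepB sepG Bq).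
  have [cSp | cSq] := nonadjacent_central_Sylows pr_p pr_q nedge.
    exact: (classB_edge_central sepG _ _ Bp Bq npq cSp nedge).
  rewrite eq_sym in npq; apply: (classB_edge_central sepG _ _ Bq Bp npq cSq) => //.
  by case=> x Gx; rewrite andbC => e; apply: nedge; exists x.
by move=> a b Aa Bb; apply: classA_edge_r sepG _ _ _ Aa Bb Vr.
Qed.

Lemma central_SylowsP p :
  reflect (central_Sylows G p)
    [forall P : {group gT}, p.-Sylow(G) P ==> ('N_G(P) \subset 'C(P))].
Proof.
by apply: (iffP forallP) => cS P; [apply/implyP: (cS P) | apply/implyP/cS].
Qed.

(** The choice of the side with central Sylow subgroups. Testing only the primes of |G| keeps the
    case distinction boolean. *)
Lemma separation_separated A B r :
  separation G A B r -> class_prime G r -> (exists p, p \in A) ->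
  (exists p, p \in B) -> separated A B r.
Proof.
move=> sepG Vr ntA ntB.
pose cS p := [forall P : {group gT}, p.-Sylow(G) P ==> ('N_G(P) \subset 'C(P))].
have [allA | /allPn[p]] := boolP (all (fun p => (p \in A) ==> cS p) (primes #|G|)).
  apply: separation_central_Sylows => // p Ap; apply/central_SylowsP.
  have [pr_p [x Gx px]] := class_primeA sepG Ap.
  have /(allP allA) : p \in primes #|G|.
    rewrite mem_primes pr_p cardG_gt0 (dvdn_trans px) //.
    by rewrite -index_cent1 dvdn_indexg.
  by rewrite Ap.
rewrite negb_imply => _ /andP[Ap ncSp].
have sepG' := separation_sym sepG.
have cSB b : b \in B -> central_Sylows G b.
  move=> Bb; have nedge : ~ class_edge G p b.
    case=> x Gx /andP[px bx].
    have [pr_p pr_b] := (prime_sepA sepG Ap, prime_sepB sepG Bb).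
    have nd (C : nat_pred) u : prime u -> u \in C -> u %| #|x ^: G| -> C^'.-nat #|x ^: G| -> False.
      move=> pr_u Cu ux C'x; have : u \in primes #|x ^: G|.
        by rewrite mem_primes pr_u ux andbT -index_cent1 indexg_gt0.
      by move/(pnatPpi C'x); rewrite !inE Cu.
    by case: (sep_class sepG Gx); [apply: nd pr_p Ap px | apply: nd pr_b Bb bx].
  have [] // := nonadjacent_central_Sylows (prime_sepA sepG Ap) (prime_sepB sepG Bb) nedge.
  by move/central_SylowsP; rewrite -/(cS p) (negPf ncSp).
have [sol eB eA near_r] := separation_central_Sylows sepG' Vr ntB cSB.
(* The clause on r comes back with A and B exchanged; deciding the edge between b and r allows the
   contraposition. *)
split=> // a b Aa Bb nar.
have [ // | nbr] := boolP [exists x in G, (b %| #|x ^: G|) && (r %| #|x ^: G|)].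
  by case/exists_inP=> x Gx ex; exists x.
case: nar; apply: near_r Bb Aa _ => -[x Gx bx]; case/negP: nbr.
by apply/exists_inP; exists x.
Qed.

Local Notation Gr := (class_graph G).

Lemma class_vertP v : v \in gverts Gr -> class_prime G v.
Proof. by move=> Vv; apply/class_vertsP; exists v. Qed.

Lemma class_edgeP v w : v \in gverts Gr -> w \in gverts Gr -> v != w ->
  reflect (class_edge G v w) (gadj Gr v w).
Proof.
move=> Vv Vw nvw; have [pr_v _] := class_vertP Vv; have [pr_w _] := class_vertP Vw.
have co_vw : coprime v w by rewrite prime_coprime // dvdn_prime2.
rewrite /= /class_adj /= [v \in _]Vv [w \in _]Vw nvw /=.
by apply: (iffP exists_inP) => -[x Gx vw]; exists x; move: vw; rewrite ?Gauss_dvd.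
Qed.

End SeparatedGroups.

Theorem theoremA (gT : finGroupType) (G : {group gT}) (r : 'I_#|G|.+1) :
  cut_vertex (class_graph G) r ->
  [/\ solvable G /\ fitting_height G <= 3,
      #|components (del_vertex (class_graph G) r)| = 2 /\
      (forall C : {set 'I_#|G|.+1},
         C \in components (del_vertex (class_graph G) r) ->
         complete_graph (induced (del_vertex (class_graph G) r) C)) &
      (complete_vertex (class_graph G) r ->
         (forall s : 'I_#|G|.+1,
            complete_vertex (class_graph G) s -> s = r) /\
         (forall s : 'I_#|G|.+1,
            cut_vertex (class_graph G) s -> s = r)) /\
      (~~ complete_vertex (class_graph G) r ->
         diameter (class_graph G) = Some 3 /\
         #|[set s : 'I_#|G|.+1 | cut_vertex (class_graph G) s]| <= 2)].
Proof.
move=> cut_r; set Gr := class_graph G in cut_r *.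
have [x0 [y0 [Vx0 Vy0 nxy0]]] := cut_vertexP cut_r.
have Vr : r \in gverts Gr by case/andP: cut_r.
(* SA is the component of [x0] and SB the rest, nonempty because of [y0]; that SB is a single
   component follows only once it is a clique. *)
pose SA := [set x in gverts Gr :\ r | connect (gadj (del_vertex Gr r)) x0 x].
pose SB := (gverts Gr :\ r) :\: SA.
have sA : SA \subset gverts Gr :\ r by apply/subsetP=> x; rewrite inE => /andP[].
have sB : SB \subset gverts Gr :\ r by apply: subsetDl.
have VA v : v \in SA -> v \in gverts Gr by move/(subsetP sA)/setD1P => [].
have VB v : v \in SB -> v \in gverts Gr by move/(subsetP sB)/setD1P => [].
have rA v : v \in SA -> v != r by move/(subsetP sA)/setD1P => [].
have rB v : v \in SB -> v != r by move/(subsetP sB)/setD1P => [].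
have defV : gverts Gr :\ r = SA :|: SB by rewrite -{1}(setID (gverts Gr :\ r) SA) (setIidPr sA).
have disjAB v w : v \in SA -> w \in SB -> v != w.
  by move=> Av /setDP[_ nAw]; apply: contraNneq nAw => <-.
have nAB : {in SA & SB, forall v w, ~~ gadj Gr v w}.
  move=> v w Av Bw; apply/negP=> vw; have [Vw] := setDP Bw.
  case/negP; rewrite inE Vw /=; have := Av; rewrite inE => /andP[_ /connect_trans]; apply.
  by rewrite connect1 // gadj_del rA // rB.
have ntA : SA != set0 by apply/set0Pn; exists x0; rewrite inE Vx0 connect0.
have ntB : SB != set0 by apply/set0Pn; exists y0; rewrite !inE in Vy0 *; rewrite Vy0 andbT.
pose A := [pred p : nat | [exists v in SA, p == v]].
pose B := [pred p : nat | [exists v in SB, p == v]].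
have inA v : (nat_of_ord v \in A) = (v \in SA).
  apply/exists_inP/idP => [[w Aw /eqP/val_inj->] // | Av]; by exists v.
have inB v : (nat_of_ord v \in B) = (v \in SB).
  apply/exists_inP/idP => [[w Bw /eqP/val_inj->] // | Bv]; by exists v.
have memA p : p \in A -> exists2 v, v \in SA & p = v.
  by case/exists_inP=> v Av /eqP; exists v.
have memB p : p \in B -> exists2 v, v \in SB & p = v.
  by case/exists_inP=> v Bv /eqP; exists v.
have sepG : separation G A B r.
  split.
  - by move=> p /orP[/memA[v /VA Vv] | /memB[v /VB Vv]] ->; apply: class_vertP.
  - move=> p /class_vertsP[v Vv ->]; rewrite inA inB.
    have [-> | nvr] := eqVneq v r; first by rewrite eqxx !orbT.
    have : v \in SA :|: SB by rewrite -defV in_setD1 nvr.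
    by rewrite in_setU orbA => ->.
  - by rewrite inA; apply/negP=> /rA; rewrite eqxx.
  - by rewrite inB; apply/negP=> /rB; rewrite eqxx.
  - by move=> _ /memA[v Av ->]; rewrite inB; apply/negP=> /(disjAB _ _ Av); rewrite eqxx.
  move=> x Gx; have nsub (S : {set 'I_#|G|.+1}) (C : nat_pred) :
      (forall p, p \in C -> exists2 v, v \in S & p = v) ->
      ~~ C^'.-nat #|x ^: G| -> exists2 v, v \in S & (v %| #|x ^: G|).
    move=> memC C'x; apply/exists_inP; apply: contraR C'x => /exists_inPn nS.
    apply/pnatP; first by rewrite -index_cent1.
    move=> p _ px; rewrite !inE; apply/negP=> /memC[v Sv Ep].
    by case/negP: (nS v Sv); rewrite -Ep.
  have [A'x | /(nsub SA A memA)[v Av vx]] := boolP (A^'.-nat #|x ^: G|); first by left.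
  have [B'x | /(nsub SB B memB)[w Bw wx]] := boolP (B^'.-nat #|x ^: G|); first by right.
  case/negP: (nAB _ _ Av Bw); apply/(class_edgeP (VA _ Av) (VB _ Bw) (disjAB _ _ Av Bw)).
  by exists x; rewrite // vx.
have ntA' : exists p, p \in A by have [v Av] := set0Pn _ ntA; exists v; rewrite inA.
have ntB' : exists p, p \in B by have [v Bv] := set0Pn _ ntB; exists v; rewrite inB.
have [sol eA eB near] := separation_separated sepG (class_vertP Vr) ntA' ntB'.
have cliqueA : {in SA &, forall v w, v != w -> gadj Gr v w}.
  move=> v w Av Aw nvw; apply: contraT => /(class_edgeP (VA _ Av) (VA _ Aw) nvw).
  by move/(eA v w); rewrite !inA => /(_ Av Aw nvw).
have cliqueB : {in SB &, forall v w, v != w -> gadj Gr v w}.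
  move=> v w Bv Bw nvw; apply: contraT => /(class_edgeP (VB _ Bv) (VB _ Bw) nvw).
  by move/(eB v w); rewrite !inB => /(_ Bv Bw nvw).
have near_r : {in SA & SB, forall v w, gadj Gr v r || gadj Gr w r}.
  move=> v w Av Bw; have [// | /(class_edgeP (VA _ Av) Vr (rA _ Av)) nvr] := boolP (gadj Gr v r).
  by apply/(class_edgeP (VB _ Bw) Vr (rB _ Bw))/(near v w); rewrite ?inA ?inB.
have djAB : [disjoint SA & SB].
  by apply/pred0P=> v /=; apply/andP=> -[Av Bv]; have := disjAB _ _ Av Bv; rewrite eqxx.
split=> //; first split.
- by apply: (@card_two_cliques _ _ _ SA SB).
- by apply: (@two_cliques_complete _ _ _ SA SB).
split=> [cpl_r | ncpl_r]; first split.
- by move=> s; apply: (@two_cliques_complete_vertex _ _ _ SA SB).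
- by move=> s; apply: complete_vertex_cut.
have [v /setD1P[nvr Vv] nrv] : exists2 v, v \in gverts Gr :\ r & ~~ gadj Gr v r.
  move: ncpl_r; rewrite /complete_vertex Vr andTb => /forall_inPn[v Vv].
  rewrite negb_imply => /andP[nvr nrv]; exists v; first by rewrite in_setD1 nvr.
  by rewrite gadj_sym.
have : v \in SA :|: SB by rewrite -defV in_setD1 nvr.
rewrite in_setU => /orP[Av | Bv].
  by apply: (@two_cliques_far _ _ _ SA SB) nrv.
apply: (@two_cliques_far _ _ _ SB SA) nrv => //.
- by rewrite setUC.
- by move=> x y Bx Ay; rewrite gadj_sym; apply: nAB.
- by move=> x y Bx Ay; rewrite orbC; apply: near_r.
by rewrite disjoint_sym.
Qed.
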